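(* For all integers $a,b,c\ge 0$ with $b\ge a+c$ and all $t\in\mathbb Z$, the objects $\mathcal E_1^{(a)}\mathcal E_2^{(b)}\mathcal E_1^{(c)}\{t\}$ and $\mathcal E_2^{(a)}\mathcal E_1^{(b)}\mathcal E_2^{(c)}\{t\}$ are indecomposable in $\dot{\mathcal U}^+_3$. No two of these objects (for distinct choices of family and of parameters $(a,b,c,t)$) are isomorphic, except that $$\mathcal E_1^{(a)}\mathcal E_2^{(a+c)}\mathcal E_1^{(c)}\{t\}\cong\mathcal E_2^{(c)}\mathcal E_1^{(a+c)}\mathcal E_2^{(a)}\{t\}\qquad\text{for all } a,c\ge 0,\ t\in\mathbb Z.$$
   Context: The category $\mathcal U^+_3$. Put $i\cdot i=2$ for $i\in\{1,2\}$ and $1\cdot 2=2\cdot 1=-1$. Let $\mathcal H$ be the strict monoidal $\mathbb Z$-linear category with $\mathbb Z$-graded Hom groups, generated by objects $\mathcal E_1,\mathcal E_2$ (tensor product written as juxtaposition of objects) and morphisms $x_i:\mathcal E_i\to\mathcal E_i$ of degree $2$ (a dot) and $\tau_{ij}:\mathcal E_i\mathcal E_j\to\mathcal E_j\mathcal E_i$ of degree $-i\cdot j$ (a crossing), for $i,j\in\{1,2\}$, subject to the following relations ($1$ denotes identity morphisms, products are compositions with the rightmost factor applied first): (1) $\tau_{ii}(x_i\otimes 1)-(1\otimes x_i)\tau_{ii}=1=(x_i\otimes 1)\tau_{ii}-\tau_{ii}(1\otimes x_i)$; (2) $\tau_{ii}\tau_{ii}=0$; (3) for $i\ne j$: $\tau_{ji}\tau_{ij}=x_i\otimes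 1+1\otimes x_j$; (4) for $i\neq j$: $(x_j\otimes 1)\tau_{ij}=\tau_{ij}(1\otimes x_j)$ and $(1\otimes x_i)\tau_{ij}=\tau_{ij}(x_i\otimes 1)$; (5) for all $i,j,k$: $(\tau_{jk}\otimes 1)(1\otimes\tau_{ik})(\tau_{ij}\otimes 1)-(1\otimes\tau_{ij})(\tau_{ik}\otimes 1)(1\otimes\tau_{jk})$ equals $1$ if $i=k\ne j$ and equals $0$ otherwise. Objects of $\mathcal U^+_3$ are formal finite direct sums of $\mathcal E_{i_1}\cdots\mathcal E_{i_k}\{t\}$ with $t\in\mathbb Z$, $i_s\in\{1,2\}$, $k\geq 0$; the group $\mathrm{Hom}(X\{t\},Y\{t'\})$ is the homogeneous part of degree $t-t'$ of $\mathrm{Hom}_{\mathcal H}(X,Y)$. It is monoidal, with shifts adding under tensor product. $\dot{\mathcal U}^+_3$ is the Karoubi envelope (idempotent completion) of $\mathcal U^+_3$; its objects are pairs $(X,e)$ with $e$ an idempotent endomorphism of $X$. The shift $\{t\}$ extends to all objects. Divided powers. On $\mathcal E_i^a=\mathcal E_i\cdots\mathcal E_i$ let $x_1,\dots,x_a$ denote the dots on the strands numbered left to right, $\delta_a=x_1^{a-1}x_2^{a-2}\cdots x_{a-1}$, and $D_a$ the composite of crossings $\tau_{ii}$ along a reduced word of the longest element of the symmetric group $S_a$. Then $e_a=\delta_aD_a$ is an idempotent of degree $0$, and $\mathcal E_i^{(a)}:=(\mathcal E_i^a,e_a)\{-a(a-1)/2\}$, with $\mathcal E_i^{(0)}$ the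 monoidal unit. *)

(* Defs.v *)
From HB Require Import structures.
From mathcomp Require Import all_boot all_order all_algebra.
From mathcomp Require Import boolp.

Set Implicit Arguments.
Unset Strict Implicit.
Unset Printing Implicit Defensive.

Import GRing.Theory.
Local Open Scope ring_scope.
Local Open Scope quotient_scope.

(* Preadditive categories. *)
Record precat := Precat {
  obj :> Type;
  hom : obj -> obj -> zmodType;
  idm : forall A, hom A A;
  comp : forall A B C, hom B C -> hom A B -> hom A C;
  compA : forall A B C D (h : hom C D) (g : hom B C) (f : hom A B),
    comp h (comp g f) = comp (comp h g) f;
  comp1m : forall A B (f : hom A B), comp (idm B) f = f;
  compm1 : forall A B (f : hom A B), comp f (idm A) = f;
  compDl : forall A B C (g g' : hom B C) (f : hom A B),
    comp (g + g') f = comp g f + comp g' f;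
  compDr : forall A B C (g : hom B C) (f f' : hom A B),
    comp g (f + f') = comp g f + comp g f' }.

Declare Scope cat_scope.
Delimit Scope cat_scope with C.
Notation "g ∘ f" := (comp g f) (at level 40, left associativity) : cat_scope.
Local Open Scope cat_scope.

Section PrecatTheory.
Variable C : precat.

Lemma comp0m (X Y Z : C) (f : hom X Y) : (0 : hom Y Z) ∘ f = 0.
Proof. by apply: (@addrI _ (0 ∘ f)); rewrite -compDl !addr0. Qed.

Lemma compm0 (X Y Z : C) (g : hom Y Z) : g ∘ (0 : hom X Y) = 0.
Proof. by apply: (@addrI _ (g ∘ 0)); rewrite -compDr !addr0. Qed.

Lemma compNm (X Y Z : C) (g : hom Y Z) (f : hom X Y) : (- g) ∘ f = - (g ∘ f).
Proof. by apply: (@addrI _ (g ∘ f)); rewrite -compDl !subrr comp0m. Qed.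

Lemma compmN (X Y Z : C) (g : hom Y Z) (f : hom X Y) : g ∘ (- f) = - (g ∘ f).
Proof. by apply: (@addrI _ (g ∘ f)); rewrite -compDr !subrr compm0. Qed.

Lemma comp_suml (X Y Z : C) (I : finType) (P : pred I)
    (g : I -> hom Y Z) (f : hom X Y) :
  (\sum_(i | P i) g i) ∘ f = \sum_(i | P i) (g i ∘ f).
Proof.
by apply: (big_morph (fun g => g ∘ f)) => [x y|]; rewrite ?compDl ?comp0m.
Qed.

Lemma comp_sumr (X Y Z : C) (I : finType) (P : pred I)
    (g : hom Y Z) (f : I -> hom X Y) :
  g ∘ (\sum_(i | P i) f i) = \sum_(i | P i) (g ∘ f i).
Proof.
by apply: (big_morph (fun f => g ∘ f)) => [x y|]; rewrite ?compDr ?compm0.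
Qed.

Definition isomorphic (X Y : C) : Prop :=
  exists (f : hom X Y) (g : hom Y X), g ∘ f = idm X /\ f ∘ g = idm Y.

Definition zero_object (X : C) : Prop :=
  (forall Y (f g : hom X Y), f = g) /\ (forall Y (f g : hom Y X), f = g).

Definition biproduct (X Y Z : C) : Prop :=
  exists (i1 : hom Y X) (p1 : hom X Y) (i2 : hom Z X) (p2 : hom X Z),
    [/\ p1 ∘ i1 = idm Y, p2 ∘ i2 = idm Z, p2 ∘ i1 = 0, p1 ∘ i2 = 0
      & i1 ∘ p1 + i2 ∘ p2 = idm X].

Definition indecomposable (X : C) : Prop :=
  ~ zero_object X /\
  forall Y Z, biproduct X Y Z -> zero_object Y \/ zero_object Z.

End PrecatTheory.

(* Formal finite direct sums are families indexed by a finite type, so that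
   direct sum and tensor product of objects are indexed by I + J and I * J;
   [M q p] is the entry from the summand [p] to the summand [q]. *)

Section AdditiveClosure.
Variable C : precat.

Record family := Family { fidx : finType; fob :> fidx -> C }.

Definition mat (X Y : family) : Type :=
  forall (q : fidx Y) (p : fidx X), hom (X p) (Y q).

Section MatZmod.
Variables X Y : family.

HB.instance Definition _ := gen_eqMixin (mat X Y).
HB.instance Definition _ := gen_choiceMixin (mat X Y).

Lemma matP (M N : mat X Y) : (forall q p, M q p = N q p) -> M = N.
Proof.
by move=> e; apply: functional_extensionality_dep => q;
   apply: functional_extensionality_dep => p.
Qed.

Let mat0 : mat X Y := fun _ _ => 0.
Let matN (M : mat X Y) : mat X Y := fun q p => - M q p.
Let matD (M N : mat X Y) : mat X Y := fun q p => M q p + N q p.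

Let matDA : associative matD.
Proof. by move=> L M N; apply: matP => q p; apply: addrA. Qed.
Let matDC : commutative matD.
Proof. by move=> M N; apply: matP => q p; apply: addrC. Qed.
Let mat0D : left_id mat0 matD.
Proof. by move=> M; apply: matP => q p; apply: add0r. Qed.
Let matND : left_inverse mat0 matN matD.
Proof. by move=> M; apply: matP => q p; apply: addNr. Qed.

HB.instance Definition _ :=
  GRing.isZmodule.Build (mat X Y) matDA matDC mat0D matND.

Lemma matDE (M N : mat X Y) q p : (M + N) q p = M q p + N q p.
Proof. by []. Qed.
End MatZmod.

(* Diagonal entries are identities up to transport along [p = q]. *)
Definition mat1 (X : family) : mat X X := fun q p =>
  if @eqP _ p q is ReflectT e then
    eq_rect p (fun r => hom (X p) (X r)) (idm (X p)) q e
  else 0.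

Definition matM (X Y Z : family) (M : mat Y Z) (N : mat X Y) : mat X Z :=
  fun r p => \sum_q M r q ∘ N q p.

Lemma mat1_diag X p : @mat1 X p p = idm (X p).
Proof. by rewrite /mat1; case: eqP => // e; rewrite (eq_axiomK e). Qed.

Lemma mat1_off X p q : p != q -> @mat1 X q p = 0.
Proof. by rewrite /mat1; case: eqP. Qed.

Fact matM_A (X Y Z W : family) (L : mat Z W) (M : mat Y Z) (N : mat X Y) :
  matM L (matM M N) = matM (matM L M) N.
Proof.
apply: matP => s p; rewrite /matM.
under eq_bigr do rewrite comp_sumr.
rewrite exchange_big; apply: eq_bigr => q _; rewrite comp_suml.
by apply: eq_bigr => r _; rewrite compA.
Qed.

Fact matM_1m (X Y : family) (M : mat X Y) : matM (@mat1 Y) M = M.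
Proof.
apply: matP => q p; rewrite /matM (bigD1 q) //= mat1_diag comp1m big1 ?addr0 //.
by move=> r rq; rewrite mat1_off // comp0m.
Qed.

Fact matM_m1 (X Y : family) (M : mat X Y) : matM M (@mat1 X) = M.
Proof.
apply: matP => q p; rewrite /matM (bigD1 p) //= mat1_diag compm1 big1 ?addr0 //.
by move=> r rp; rewrite mat1_off ?compm0 // eq_sym.
Qed.

Fact matM_Dl (X Y Z : family) (M M' : mat Y Z) (N : mat X Y) :
  matM (M + M') N = matM M N + matM M' N.
Proof.
apply: matP => r p; rewrite matDE /matM -big_split /=.
by apply: eq_bigr => q _; rewrite -compDl.
Qed.

Fact matM_Dr (X Y Z : family) (M : mat Y Z) (N N' : mat X Y) :
  matM M (N + N') = matM M N + matM M N'.
Proof.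
apply: matP => r p; rewrite matDE /matM -big_split /=.
by apply: eq_bigr => q _; rewrite -compDr.
Qed.

Definition additive_closure : precat :=
  @Precat family (fun X Y => mat X Y : zmodType) mat1 matM
    matM_A matM_1m matM_m1 matM_Dl matM_Dr.

End AdditiveClosure.

Section Karoubi.
Variable C : precat.

Record kobj := KObj {
  kcar : C;
  kidem : hom kcar kcar;
  kidemP : kidem ∘ kidem = kidem }.

Section KHom.
Variables A B : kobj.

Definition kar_pred : {pred hom (kcar A) (kcar B)} :=
  fun f => kidem B ∘ f ∘ kidem A == f.

Fact kar_pred_zmod : zmod_closed kar_pred.
Proof.
split=> [|f g]; rewrite !unfold_in ?compm0 ?comp0m //.
by move=> /eqP ef /eqP eg; rewrite compDr compDl compmN compNm ef eg.
Qed.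
HB.instance Definition _ := GRing.isZmodClosed.Build _ kar_pred kar_pred_zmod.

Record khom := KHom { kval :> hom (kcar A) (kcar B); _ : kval \in kar_pred }.
HB.instance Definition _ := [isSub for kval].
HB.instance Definition _ := [Choice of khom by <:].
HB.instance Definition _ := [SubChoice_isSubZmodule of khom by <:].

Lemma khomP (f : khom) : kidem B ∘ f ∘ kidem A = f.
Proof. exact/eqP/(valP f). Qed.

Lemma kar_predP (f : hom (kcar A) (kcar B)) :
  kidem B ∘ f ∘ kidem A = f -> f \in kar_pred.
Proof. by move=> e; apply/eqP. Qed.

Lemma khom_l (f : khom) : kidem B ∘ f = f.
Proof. by rewrite -[in LHS]khomP !compA kidemP khomP. Qed.

Lemma khom_r (f : khom) : kval f ∘ kidem A = f.
Proof. by rewrite -[in LHS]khomP -!compA kidemP compA khomP. Qed.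

Lemma kvalD (f g : khom) : kval (f + g) = kval f + kval g.
Proof. exact: (raddfD (val : khom -> _)). Qed.
End KHom.

Fact kid_subproof (A : kobj) : kidem A \in @kar_pred A A.
Proof. by apply: kar_predP; rewrite !kidemP. Qed.
Definition kid (A : kobj) : khom A A := KHom (kid_subproof A).

Fact kcomp_subproof (A B D : kobj) (g : khom B D) (f : khom A B) :
  kval g ∘ f \in @kar_pred A D.
Proof. by apply: kar_predP; rewrite !compA khom_l -compA khom_r. Qed.
Definition kcomp (A B D : kobj) (g : khom B D) (f : khom A B) : khom A D :=
  KHom (kcomp_subproof g f).

Fact kcompA (A B D E : kobj) (h : khom D E) (g : khom B D) (f : khom A B) :
  kcomp h (kcomp g f) = kcomp (kcomp h g) f.
Proof. by apply: val_inj; apply: compA. Qed.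
Fact kcomp1m (A B : kobj) (f : khom A B) : kcomp (kid B) f = f.
Proof. by apply: val_inj; apply: khom_l. Qed.
Fact kcompm1 (A B : kobj) (f : khom A B) : kcomp f (kid A) = f.
Proof. by apply: val_inj; apply: khom_r. Qed.
Fact kcompDl (A B D : kobj) (g g' : khom B D) (f : khom A B) :
  kcomp (g + g') f = kcomp g f + kcomp g' f.
Proof. by apply: val_inj; apply: compDl. Qed.
Fact kcompDr (A B D : kobj) (g : khom B D) (f f' : khom A B) :
  kcomp g (f + f') = kcomp g f + kcomp g f'.
Proof. by apply: val_inj; apply: compDr. Qed.

Definition karoubi : precat :=
  @Precat kobj (fun A B => khom A B : zmodType) kid kcomp
    kcompA kcomp1m kcompm1 kcompDl kcompDr.

End Karoubi.

Variant node := n1 | n2.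

Definition other (i : node) : node := if i is n1 then n2 else n1.

Definition pairing (i j : node) : int :=
  match i, j with n1, n1 | n2, n2 => 2 | _, _ => -1 end.

Notation word := (seq node).

(* Hom(u, v) in the strict monoidal category H is the quotient of the raw
   expressions [tm u v] by [tm_eq]. The unit object is the empty word. *)
Inductive tm : word -> word -> Type :=
| t_id (u : word) : tm u u
| t_dot (i : node) : tm [:: i] [:: i]
| t_cross (i j : node) : tm [:: i; j] [:: j; i]
| t_comp (u v w : word) (g : tm v w) (f : tm u v) : tm u w
| t_tens (u v u' v' : word) (f : tm u v) (f' : tm u' v') :
    tm (u ++ u') (v ++ v')
| t_zero (u v : word) : tm u v
| t_add (u v : word) (f g : tm u v) : tm u v
| t_opp (u v : word) (f : tm u v) : tm u v.

(* Strict associativity and the right unit law relate words that are equal but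
   not convertible; [tm_cast] transports along these equalities. *)
Definition tm_cast (u u' v v' : word) (eu : u = u') (ev : v = v') (f : tm u v) :
    tm u' v' :=
  eq_rect u (fun a => tm a v') (eq_rect v (tm u) f v' ev) u' eu.

Arguments t_zero {u v}.

Declare Scope tm_scope.
Delimit Scope tm_scope with tm.
Bind Scope tm_scope with tm.
Notation "g ∘ f" := (t_comp g f) (at level 40, left associativity) : tm_scope.
Notation "f ⊗ g" := (t_tens f g) (at level 35, right associativity) : tm_scope.
Notation "f + g" := (t_add f g) : tm_scope.
Notation "- f" := (t_opp f) : tm_scope.
Notation "f - g" := (t_add f (t_opp g)) : tm_scope.
Notation "0" := t_zero : tm_scope.

Reserved Notation "f ≡ g" (at level 70, no associativity).

Local Notation I i := (t_id [:: i]).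

Inductive tm_eq : forall u v : word, tm u v -> tm u v -> Prop :=
| te_refl u v (f : tm u v) : f ≡ f
| te_sym u v (f g : tm u v) : f ≡ g -> g ≡ f
| te_trans u v (f g h : tm u v) : f ≡ g -> g ≡ h -> f ≡ h
| te_comp u v w (g g' : tm v w) (f f' : tm u v) :
    g ≡ g' -> f ≡ f' -> g ∘ f ≡ g' ∘ f'
| te_tens u v u' v' (f g : tm u v) (f' g' : tm u' v') :
    f ≡ g -> f' ≡ g' -> f ⊗ f' ≡ g ⊗ g'
| te_add u v (f f' g g' : tm u v) : f ≡ f' -> g ≡ g' -> f + g ≡ f' + g'
| te_opp u v (f f' : tm u v) : f ≡ f' -> - f ≡ - f'
| ax_addA u v (f g h : tm u v) : f + (g + h) ≡ f + g + h
| ax_addC u v (f g : tm u v) : f + g ≡ g + f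
| ax_add0 u v (f : tm u v) : 0 + f ≡ f
| ax_addN u v (f : tm u v) : - f + f ≡ 0
| ax_compA u v w z (h : tm w z) (g : tm v w) (f : tm u v) :
    h ∘ (g ∘ f) ≡ h ∘ g ∘ f
| ax_comp1m u v (f : tm u v) : t_id v ∘ f ≡ f
| ax_compm1 u v (f : tm u v) : f ∘ t_id u ≡ f
| ax_compDl u v w (g g' : tm v w) (f : tm u v) : (g + g') ∘ f ≡ g ∘ f + g' ∘ f
| ax_compDr u v w (g : tm v w) (f f' : tm u v) : g ∘ (f + f') ≡ g ∘ f + g ∘ f'
| ax_tens1 u v : t_id u ⊗ t_id v ≡ t_id (u ++ v)
| ax_tens_comp u v w u' v' w'
    (g : tm v w) (f : tm u v) (g' : tm v' w') (f' : tm u' v') :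
    (g ∘ f) ⊗ (g' ∘ f') ≡ (g ⊗ g') ∘ (f ⊗ f')
| ax_tensDl u v u' v' (f g : tm u v) (f' : tm u' v') :
    (f + g) ⊗ f' ≡ f ⊗ f' + g ⊗ f'
| ax_tensDr u v u' v' (f : tm u v) (f' g' : tm u' v') :
    f ⊗ (f' + g') ≡ f ⊗ f' + f ⊗ g'
| ax_tensA u v u' v' u'' v'' (f : tm u v) (f' : tm u' v') (f'' : tm u'' v'') :
    tm_cast (catA u u' u'') (catA v v' v'') (f ⊗ (f' ⊗ f'')) ≡ (f ⊗ f') ⊗ f''
| ax_tens1m u v (f : tm u v) : t_id [::] ⊗ f ≡ f
| ax_tensm1 u v (f : tm u v) :
    tm_cast (cats0 u) (cats0 v) (f ⊗ t_id [::]) ≡ f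
| ax_nil_l i :
    t_cross i i ∘ (t_dot i ⊗ I i) - (I i ⊗ t_dot i) ∘ t_cross i i ≡ t_id [:: i; i]
| ax_nil_r i :
    (t_dot i ⊗ I i) ∘ t_cross i i - t_cross i i ∘ (I i ⊗ t_dot i) ≡ t_id [:: i; i]
| ax_sq_eq i : t_cross i i ∘ t_cross i i ≡ 0
| ax_sq_neq i j : i <> j ->
    t_cross j i ∘ t_cross i j ≡ t_dot i ⊗ I j + I i ⊗ t_dot j
| ax_slide_l i j : i <> j ->
    (t_dot j ⊗ I i) ∘ t_cross i j ≡ t_cross i j ∘ (I i ⊗ t_dot j)
| ax_slide_r i j : i <> j ->
    (I j ⊗ t_dot i) ∘ t_cross i j ≡ t_cross i j ∘ (t_dot i ⊗ I j)
| ax_braid_iji i j : i <> j ->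
    (t_cross j i ⊗ I i) ∘ (I j ⊗ t_cross i i) ∘ (t_cross i j ⊗ I i)
    - (I i ⊗ t_cross i j) ∘ (t_cross i i ⊗ I j) ∘ (I i ⊗ t_cross j i)
    ≡ t_id [:: i; j; i]
| ax_braid i j k : ~ (i = k /\ i <> j) ->
    (t_cross j k ⊗ I i) ∘ (I j ⊗ t_cross i k) ∘ (t_cross i j ⊗ I k)
    - (I k ⊗ t_cross i j) ∘ (t_cross i k ⊗ I j) ∘ (I i ⊗ t_cross j k)
    ≡ 0
where "f ≡ g" := (tm_eq f%tm g%tm).

(* [tm_deg f d]: the expression [f] is homogeneous of degree [d]
   (zero is homogeneous of every degree). *)
Inductive tm_deg : forall u v : word, tm u v -> int -> Prop :=
| deg_id u : tm_deg (t_id u) 0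
| deg_dot i : tm_deg (t_dot i) 2
| deg_cross i j : tm_deg (t_cross i j) (- pairing i j)
| deg_comp u v w (g : tm v w) (f : tm u v) d d' :
    tm_deg g d -> tm_deg f d' -> tm_deg (t_comp g f) (d + d')
| deg_tens u v u' v' (f : tm u v) (f' : tm u' v') d d' :
    tm_deg f d -> tm_deg f' d' -> tm_deg (t_tens f f') (d + d')
| deg_zero u v d : tm_deg (@t_zero u v) d
| deg_add u v (f g : tm u v) d :
    tm_deg f d -> tm_deg g d -> tm_deg (t_add f g) d
| deg_opp u v (f : tm u v) d : tm_deg f d -> tm_deg (t_opp f) d.

Section HHom.
Variables u v : word.

HB.instance Definition _ := gen_eqMixin (tm u v).
HB.instance Definition _ := gen_choiceMixin (tm u v).

Definition tm_eqb : rel (tm u v) := fun f g => `[< tm_eq f g >].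

Fact tm_eqb_refl : reflexive tm_eqb.
Proof. by move=> f; apply/asboolP; apply: te_refl. Qed.
Fact tm_eqb_sym : symmetric tm_eqb.
Proof. by move=> f g; apply/asboolP/asboolP; apply: te_sym. Qed.
Fact tm_eqb_trans : transitive tm_eqb.
Proof.
move=> g f h /asboolP fg /asboolP gh; apply/asboolP; exact: te_trans fg gh.
Qed.
Canonical tm_eqb_equiv := EquivRel tm_eqb tm_eqb_refl tm_eqb_sym tm_eqb_trans.

Definition Hhom := {eq_quot tm_eqb}.
HB.instance Definition _ := EqQuotient.on Hhom.
HB.instance Definition _ := Choice.on Hhom.

Definition cls (f : tm u v) : Hhom := \pi_Hhom f.

Lemma clsP (f g : tm u v) : cls f = cls g <-> tm_eq f g.
Proof. by split=> [/eqmodP/asboolP|fg] //; apply/eqmodP/asboolP. Qed.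

Lemma clsK (f : Hhom) : cls (repr f) = f.
Proof. exact: reprK. Qed.

Lemma clsW (P : Hhom -> Prop) : (forall f, P (cls f)) -> forall f, P f.
Proof. by move=> Pcls f; rewrite -(clsK f). Qed.

Lemma repr_cls (f : tm u v) : tm_eq (repr (cls f)) f.
Proof. by apply/clsP; rewrite clsK. Qed.

Let H0 : Hhom := cls t_zero.
Let HN (f : Hhom) : Hhom := cls (t_opp (repr f)).
Let HD (f g : Hhom) : Hhom := cls (t_add (repr f) (repr g)).

Let HDE f g : HD (cls f) (cls g) = cls (t_add f g).
Proof. by apply/clsP; apply: te_add; apply: repr_cls. Qed.
Let HNE f : HN (cls f) = cls (t_opp f).
Proof. by apply/clsP; apply: te_opp; apply: repr_cls. Qed.

Let HDA : associative HD.
Proof.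
move=> f g h; rewrite -(clsK f) -(clsK g) -(clsK h) !HDE.
by apply/clsP; apply: ax_addA.
Qed.
Let HDC : commutative HD.
Proof. by move=> f g; apply/clsP; apply: ax_addC. Qed.
Let H0D : left_id H0 HD.
Proof. by move=> f; rewrite -(clsK f) HDE; apply/clsP; apply: ax_add0. Qed.
Let HND : left_inverse H0 HN HD.
Proof. by move=> f; rewrite -(clsK f) HNE HDE; apply/clsP; apply: ax_addN. Qed.

HB.instance Definition _ := GRing.isZmodule.Build Hhom HDA HDC H0D HND.

Lemma cls0 : cls t_zero = 0. Proof. by []. Qed.
Lemma clsD f g : cls (t_add f g) = cls f + cls g.
Proof. by rewrite -HDE. Qed.
Lemma clsN f : cls (t_opp f) = - cls f.
Proof. by rewrite -HNE. Qed.

(* All relations are homogeneous, so the classes of homogeneous expressions of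
   degree [d] form the degree [d] part of Hom(u, v). *)
Definition homog (d : int) : {pred Hhom} :=
  fun f => `[< exists2 t, cls t = f & tm_deg t d >].

Fact homog_zmod d : zmod_closed (homog d).
Proof.
split=> [|f g]; first by apply/asboolP; exists t_zero => //; apply: deg_zero.
move=> /asboolP[s <- ds] /asboolP[t <- dt]; apply/asboolP.
exists (t_add s (t_opp t)); first by rewrite clsD clsN.
by apply: deg_add => //; apply: deg_opp.
Qed.
HB.instance Definition _ d := GRing.isZmodClosed.Build _ (homog d) (homog_zmod d).

End HHom.

Definition Hid (u : word) : Hhom u u := cls (t_id u).
Definition Hcomp (u v w : word) (g : Hhom v w) (f : Hhom u v) : Hhom u w :=
  cls (t_comp (repr g) (repr f)).
Definition Htens (u v u' v' : word) (f : Hhom u v) (f' : Hhom u' v') :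
    Hhom (u ++ u') (v ++ v') :=
  cls (t_tens (repr f) (repr f')).

Lemma cls_comp u v w (g : tm v w) (f : tm u v) :
  cls (t_comp g f) = Hcomp (cls g) (cls f).
Proof. by apply/clsP; apply: te_sym; apply: te_comp; apply: repr_cls. Qed.

Lemma cls_tens u v u' v' (f : tm u v) (f' : tm u' v') :
  cls (t_tens f f') = Htens (cls f) (cls f').
Proof. by apply/clsP; apply: te_sym; apply: te_tens; apply: repr_cls. Qed.

Fact Hcomp_A u v w z (h : Hhom w z) (g : Hhom v w) (f : Hhom u v) :
  Hcomp h (Hcomp g f) = Hcomp (Hcomp h g) f.
Proof.
elim/clsW: f => f; elim/clsW: g => g; elim/clsW: h => h.
by rewrite -!cls_comp; apply/clsP; apply: ax_compA.
Qed.
Fact Hcomp_1m u v (f : Hhom u v) : Hcomp (Hid v) f = f.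
Proof. by elim/clsW: f => f; rewrite -(cls_comp (t_id v) f); apply/clsP; apply: ax_comp1m. Qed.
Fact Hcomp_m1 u v (f : Hhom u v) : Hcomp f (Hid u) = f.
Proof. by elim/clsW: f => f; rewrite -(cls_comp f (t_id u)); apply/clsP; apply: ax_compm1. Qed.
Fact Hcomp_Dl u v w (g g' : Hhom v w) (f : Hhom u v) :
  Hcomp (g + g') f = Hcomp g f + Hcomp g' f.
Proof.
elim/clsW: f => f; elim/clsW: g => g; elim/clsW: g' => g'.
rewrite -(clsD g) -!(cls_comp _ f) -(clsD (t_comp g f)).
by apply/clsP; apply: ax_compDl.
Qed.
Fact Hcomp_Dr u v w (g : Hhom v w) (f f' : Hhom u v) :
  Hcomp g (f + f') = Hcomp g f + Hcomp g f'.
Proof.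
elim/clsW: g => g; elim/clsW: f => f; elim/clsW: f' => f'.
rewrite -(clsD f) -!(cls_comp g) -(clsD (t_comp g f)).
by apply/clsP; apply: ax_compDr.
Qed.

Definition Hcat : precat :=
  @Precat word (fun u v => Hhom u v : zmodType) Hid Hcomp
    Hcomp_A Hcomp_1m Hcomp_m1 Hcomp_Dl Hcomp_Dr.

Lemma Htens1 u v : Htens (Hid u) (Hid v) = Hid (u ++ v).
Proof. by rewrite -cls_tens; apply/clsP; apply: ax_tens1. Qed.

Lemma Htens_comp u v w u' v' w'
    (g : Hhom v w) (f : Hhom u v) (g' : Hhom v' w') (f' : Hhom u' v') :
  Htens (Hcomp g f) (Hcomp g' f') = Hcomp (Htens g g') (Htens f f').
Proof.
elim/clsW: g => g; elim/clsW: f => f; elim/clsW: g' => g'; elim/clsW: f' => f'.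
rewrite -(cls_comp g) -(cls_comp g') -(cls_tens g) -(cls_tens f).
rewrite -(cls_tens (t_comp g f)) -(cls_comp (t_tens g g')).
by apply/clsP; apply: ax_tens_comp.
Qed.

Lemma HtensDl u v u' v' (f g : Hhom u v) (f' : Hhom u' v') :
  Htens (f + g) f' = Htens f f' + Htens g f'.
Proof.
elim/clsW: f => f; elim/clsW: g => g; elim/clsW: f' => f'.
rewrite -(clsD f) -!(cls_tens _ f') -(clsD (t_tens f f')).
by apply/clsP; apply: ax_tensDl.
Qed.

Lemma HtensDr u v u' v' (f : Hhom u v) (f' g' : Hhom u' v') :
  Htens f (f' + g') = Htens f f' + Htens f g'.
Proof.
elim/clsW: f => f; elim/clsW: f' => f'; elim/clsW: g' => g'.
rewrite -(clsD f') -!(cls_tens f) -(clsD (t_tens f f')).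
by apply/clsP; apply: ax_tensDr.
Qed.

Lemma homog_cls u v (t : tm u v) d : tm_deg t d -> cls t \in homog d.
Proof. by move=> dt; apply/asboolP; exists t. Qed.

Lemma homog_id u : Hid u \in homog 0.
Proof. by apply: homog_cls; apply: deg_id. Qed.

Lemma homog_comp u v w (g : Hhom v w) (f : Hhom u v) d d' :
  g \in homog d -> f \in homog d' -> Hcomp g f \in homog (d + d').
Proof.
move=> /asboolP[s <- ds] /asboolP[t <- dt]; rewrite -cls_comp.
by apply: homog_cls; apply: deg_comp.
Qed.

Lemma homog_tens u v u' v' (f : Hhom u v) (f' : Hhom u' v') d d' :
  f \in homog d -> f' \in homog d' ->
  Htens f f' \in homog (d + d').
Proof.
move=> /asboolP[s <- ds] /asboolP[t <- dt]; rewrite -cls_tens.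
by apply: homog_cls; apply: deg_tens.
Qed.

(* [(u, t)] stands for the product of the generators along [u], shifted by {t};
   morphisms from u{t} to v{t'} are homogeneous of degree t - t'. *)
Notation sword := (word * int)%type.

Section SHom.
Variables A B : sword.

Record shom := SHom {
  sval :> Hhom A.1 B.1;
  _ : sval \in homog (A.2 - B.2) }.
HB.instance Definition _ := [isSub for sval].
HB.instance Definition _ := [Choice of shom by <:].
HB.instance Definition _ := [SubChoice_isSubZmodule of shom by <:].

Lemma svalD (f g : shom) : sval (f + g) = sval f + sval g.
Proof. exact: (raddfD (val : shom -> _)). Qed.
End SHom.

Fact sid_subproof (A : sword) : Hid A.1 \in homog (A.2 - A.2).
Proof. by rewrite subrr homog_id. Qed.
Definition sid (A : sword) : shom A A := SHom (sid_subproof A).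

Fact scomp_subproof (A B D : sword) (g : shom B D) (f : shom A B) :
  Hcomp g f \in homog (A.2 - D.2).
Proof.
have -> : A.2 - D.2 = (B.2 - D.2) + (A.2 - B.2) by rewrite [RHS]addrC subrKA.
by apply: homog_comp; apply: valP.
Qed.
Definition scomp (A B D : sword) (g : shom B D) (f : shom A B) : shom A D :=
  SHom (scomp_subproof g f).

Fact scompA (A B D E : sword) (h : shom D E) (g : shom B D) (f : shom A B) :
  scomp h (scomp g f) = scomp (scomp h g) f.
Proof. by apply: val_inj; apply: Hcomp_A. Qed.
Fact scomp1m (A B : sword) (f : shom A B) : scomp (sid B) f = f.
Proof. by apply: val_inj; apply: Hcomp_1m. Qed.
Fact scompm1 (A B : sword) (f : shom A B) : scomp f (sid A) = f.
Proof. by apply: val_inj; apply: Hcomp_m1. Qed.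
Fact scompDl (A B D : sword) (g g' : shom B D) (f : shom A B) :
  scomp (g + g') f = scomp g f + scomp g' f.
Proof. by apply: val_inj; apply: Hcomp_Dl. Qed.
Fact scompDr (A B D : sword) (g : shom B D) (f f' : shom A B) :
  scomp g (f + f') = scomp g f + scomp g f'.
Proof. by apply: val_inj; apply: Hcomp_Dr. Qed.

Definition Scat : precat :=
  @Precat sword (fun A B => shom A B : zmodType) sid scomp
    scompA scomp1m scompm1 scompDl scompDr.

Definition sshift (t : int) (A : Scat) : Scat := (A.1, A.2 + t).

Fact sshift_subproof t (A B : Scat) (f : hom A B) :
  sval f \in homog ((sshift t A).2 - (sshift t B).2).
Proof.
have -> : (sshift t A).2 - (sshift t B).2 = A.2 - B.2.
  by rewrite /sshift /= opprD addrACA subrr addr0.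
exact: valP.
Qed.
Definition sshift_hom t (A B : Scat) (f : hom A B) :
    @hom Scat (sshift t A) (sshift t B) :=
  @SHom (sshift t A) (sshift t B) (sval f) (sshift_subproof t f).
Arguments sshift_hom t {A B} f.

Definition stens (A B : Scat) : Scat := (A.1 ++ B.1, A.2 + B.2).

Fact stens_subproof (A B A' B' : Scat) (f : hom A B) (f' : hom A' B') :
  Htens (sval f) (sval f') \in
    homog ((stens A A').2 - (stens B B').2).
Proof.
have -> : (stens A A').2 - (stens B B').2 = (A.2 - B.2) + (A'.2 - B'.2).
  by rewrite /stens /= opprD addrACA.
by apply: homog_tens; apply: valP.
Qed.
Definition stens_hom (A B A' B' : Scat) (f : hom A B) (f' : hom A' B') :
    @hom Scat (stens A A') (stens B B') :=
  @SHom (stens A A') (stens B B') (Htens (sval f) (sval f'))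
    (stens_subproof f f').
Arguments stens_hom {A B A' B'} f f'.

Lemma sshift_homD t (A B : Scat) (f g : hom A B) :
  sshift_hom t (f + g) = sshift_hom t f + sshift_hom t g.
Proof. exact: val_inj. Qed.

Lemma stens_homDl (A B A' B' : Scat) (f g : hom A B) (f' : hom A' B') :
  stens_hom (f + g) f' = stens_hom f f' + stens_hom g f'.
Proof. by apply: val_inj; apply: HtensDl. Qed.

Lemma stens_homDr (A B A' B' : Scat) (f : hom A B) (f' g' : hom A' B') :
  stens_hom f (f' + g') = stens_hom f f' + stens_hom f g'.
Proof. by apply: val_inj; apply: HtensDr. Qed.

Definition U : precat := additive_closure Scat.
Definition Udot : precat := karoubi U.

Definition ushift (t : int) (X : U) : U := Family (fun p => sshift t (X p)).

Definition ushift_hom t (X Y : U) (f : hom X Y) :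
    @hom U (ushift t X) (ushift t Y) :=
  fun q p => sshift_hom t (f q p).
Arguments ushift_hom t {X Y} f.

Definition utens (X Y : U) : U :=
  Family (fun p : fidx X * fidx Y => stens (X p.1) (Y p.2)).

Definition utens_hom (X Y X' Y' : U) (f : hom X Y) (f' : hom X' Y') :
    @hom U (utens X X') (utens Y Y') :=
  fun q p => stens_hom (f q.1 p.1) (f' q.2 p.2).
Arguments utens_hom {X Y X' Y'} f f'.

Lemma ushift_comp t (X Y Z : U) (g : hom Y Z) (f : hom X Y) :
  ushift_hom t (g ∘ f) = ushift_hom t g ∘ ushift_hom t f.
Proof.
apply: matP => r p.
have s0 : @sshift_hom t (X p) (Z r) 0 = 0 by apply: val_inj.
have -> : ushift_hom t (g ∘ f) r p = sshift_hom t (\sum_q g r q ∘ f q p) by [].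
rewrite (big_morph _ (@sshift_homD t (X p) (Z r)) s0).
by apply: eq_bigr => q _; apply: val_inj.
Qed.

Lemma utens_comp (X Y Z X' Y' Z' : U)
    (g : hom Y Z) (f : hom X Y) (g' : hom Y' Z') (f' : hom X' Y') :
  utens_hom (g ∘ f) (g' ∘ f') = utens_hom g g' ∘ utens_hom f f'.
Proof.
apply: matP => r p.
have st0 A B A' B' (h : @hom Scat A' B') : stens_hom (0 : hom A B) h = 0.
  by apply: (@addrI _ (stens_hom 0 h)); rewrite -stens_homDl !addr0.
have s0t A B A' B' (h : @hom Scat A B) : stens_hom h (0 : hom A' B') = 0.
  by apply: (@addrI _ (stens_hom h 0)); rewrite -stens_homDr !addr0.
have -> : utens_hom (g ∘ f) (g' ∘ f') r p =
    stens_hom (\sum_q g r.1 q ∘ f q p.1) (\sum_q g' r.2 q ∘ f' q p.2) by [].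
rewrite (big_morph (stens_hom^~ _) (fun h k => stens_homDl h k _) (st0 _ _ _ _ _)).
under eq_bigr => q _ do
  rewrite (big_morph _ (stens_homDr (g r.1 q ∘ f q p.1)) (s0t _ _ _ _ _)).
rewrite pair_bigA; apply: eq_bigr => q _; apply: val_inj.
exact: Htens_comp.
Qed.

Fact kshift_subproof t (A : Udot) :
  ushift_hom t (kidem A) ∘ ushift_hom t (kidem A) = ushift_hom t (kidem A).
Proof. by rewrite -ushift_comp kidemP. Qed.
Definition kshift (t : int) (A : Udot) : Udot := KObj (kshift_subproof t A).

Fact ktens_subproof (A B : Udot) :
  utens_hom (kidem A) (kidem B) ∘ utens_hom (kidem A) (kidem B)
  = utens_hom (kidem A) (kidem B).
Proof. by rewrite -utens_comp !kidemP. Qed.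
Definition ktens (A B : Udot) : Udot := KObj (ktens_subproof A B).

Declare Scope udot_scope.
Delimit Scope udot_scope with udot.
Notation "A ⊗ B" := (ktens A B) (at level 35, right associativity) : udot_scope.

Section DividedPowers.
Variable i : node.

Local Notation "g ∙ f" := (Hcomp g f) (at level 40, left associativity).
Local Notation "1 ⊗ f" := (Htens (Hid [:: i]) f) (at level 35, f at level 35).

(* On E_i^(a+1), resp. E_i^(a+2): dot on the first strand, crossing of the
   first two strands. *)
Definition dot1 a : Hhom (nseq a.+1 i) (nseq a.+1 i) :=
  Htens (cls (t_dot i)) (Hid (nseq a i)).
Definition cross1 a : Hhom (nseq a.+2 i) (nseq a.+2 i) :=
  Htens (cls (t_cross i i)) (Hid (nseq a i)).

Definition dot1X a k : Hhom (nseq a.+1 i) (nseq a.+1 i) :=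
  iter k (Hcomp (dot1 a)) (Hid _).

(* delta_(a+1) = x_1^a (1 ⊗ delta_a), i.e. x_1^a x_2^(a-1) ... x_a. *)
Fixpoint delta a : Hhom (nseq a i) (nseq a i) :=
  if a is a'.+1 then dot1X a' a' ∙ (1 ⊗ delta a') else Hid [::].

(* tau_a ... tau_2 tau_1 on E_i^(a+1), where tau_k crosses strands k, k+1 *)
Fixpoint crosses a : Hhom (nseq a.+1 i) (nseq a.+1 i) :=
  if a is a'.+1 then (1 ⊗ crosses a') ∙ cross1 a' else Hid [:: i].

(* D_(a+1) = (tau_a ... tau_1) (1 ⊗ D_a), along the reduced word
   (s_a ... s_1) (s_a ... s_2) ... (s_a) of the longest element of S_(a+1). *)
Fixpoint longest a : Hhom (nseq a i) (nseq a i) :=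
  if a is a'.+1 then crosses a' ∙ (1 ⊗ longest a') else Hid [::].

(* The crossings are applied first. *)
Definition divided_idem a : Hhom (nseq a i) (nseq a i) :=
  delta a ∙ longest a.

Lemma Hcomp0m u v w (f : Hhom u v) : (0 : Hhom v w) ∙ f = 0.
Proof. exact: (@comp0m Hcat u v w f). Qed.
Lemma Hcompm0 u v w (g : Hhom v w) : g ∙ (0 : Hhom u v) = 0.
Proof. exact: (@compm0 Hcat u v w g). Qed.

Lemma Hcomp_suml u v w (I : finType) (g : I -> Hhom v w) (f : Hhom u v) :
  (\sum_l g l) ∙ f = \sum_l g l ∙ f.
Proof. exact: (@comp_suml Hcat). Qed.
Lemma Hcomp_sumr u v w (I : finType) (g : Hhom v w) (f : I -> Hhom u v) :
  g ∙ (\sum_l f l) = \sum_l g ∙ f l.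
Proof. exact: (@comp_sumr Hcat). Qed.

Lemma tensl_comp u v w (g : Hhom v w) (f : Hhom u v) :
  1 ⊗ (g ∙ f) = (1 ⊗ g) ∙ (1 ⊗ f).
Proof. by rewrite -Htens_comp Hcomp_1m. Qed.

Lemma tens0r u v u' v' (f : Hhom u' v') : Htens (0 : Hhom u v) f = 0.
Proof.
by apply: (@addrI _ (Htens (0 : Hhom u v) f)); rewrite -HtensDl !addr0.
Qed.

(* [pad m] adds [m] identity strands on the left. *)
Fixpoint padw m (u : word) : word := if m is m'.+1 then padw m' (i :: u) else u.
Fixpoint pad m : forall u v, Hhom u v -> Hhom (padw m u) (padw m v) :=
  match m with
  | 0 => fun u v f => f
  | m'.+1 => fun u v f => pad m' (1 ⊗ f)
  end.
Arguments pad m {u v} f.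

Lemma pad_comp m u v w (g : Hhom v w) (f : Hhom u v) :
  pad m (g ∙ f) = pad m g ∙ pad m f.
Proof. by elim: m u v w g f => //= m IH u v w g f; rewrite tensl_comp IH. Qed.
Lemma pad1 m u : pad m (Hid u) = Hid (padw m u).
Proof. by elim: m u => //= m IH u; rewrite -IH (Htens1 [:: i] u). Qed.
Lemma padD m u v (f g : Hhom u v) : pad m (f + g) = pad m f + pad m g.
Proof. by elim: m u v f g => //= m IH u v f g; rewrite HtensDr IH. Qed.
Lemma pad0 m u v : pad m (0 : Hhom u v) = 0.
Proof. by apply: (@addrI _ (pad m (0 : Hhom u v))); rewrite -padD !addr0. Qed.
Lemma padE m u v (f : Hhom u v) : pad m (1 ⊗ f) = pad m.+1 f.
Proof. by []. Qed.

Lemma slide u v u' v' (f : Hhom u v) (g : Hhom u' v') :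
  Htens f (Hid v') ∙ Htens (Hid u) g = Htens (Hid v) g ∙ Htens f (Hid u').
Proof. by rewrite -!Htens_comp !Hcomp_1m !Hcomp_m1. Qed.

Lemma dot1_comm a (f : Hhom (nseq a i) (nseq a i)) :
  dot1 a ∙ (1 ⊗ f) = (1 ⊗ f) ∙ dot1 a.
Proof. exact: (slide (cls (t_dot i)) f). Qed.
Lemma dot1X_comm a k (f : Hhom (nseq a i) (nseq a i)) :
  dot1X a k ∙ (1 ⊗ f) = (1 ⊗ f) ∙ dot1X a k.
Proof.
elim: k => [|k IH] /=; first by rewrite Hcomp_1m Hcomp_m1.
by rewrite -Hcomp_A IH !Hcomp_A dot1_comm.
Qed.

Lemma tm_cast_id u v (eu : u = u) (ev : v = v) (f : tm u v) :
  tm_cast eu ev f = f.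
Proof.
rewrite (_ : eu = erefl); last exact: Prop_irrelevance.
by rewrite (_ : ev = erefl) //; apply: Prop_irrelevance.
Qed.

Lemma assoc11 u v (f g : Hhom [:: i] [:: i]) (h : Hhom u v) :
  Htens f (Htens g h) = Htens (Htens f g) h.
Proof.
elim/clsW: f => f; elim/clsW: g => g; elim/clsW: h => h.
rewrite -(cls_tens g h) -(cls_tens f g) -(cls_tens f (t_tens g h)).
rewrite -(cls_tens (t_tens f g) h); apply/clsP.
by have := ax_tensA f g h; rewrite tm_cast_id.
Qed.
Lemma assoc12 u v (f : Hhom [:: i] [:: i]) (g : Hhom [:: i; i] [:: i; i])
    (h : Hhom u v) :
  Htens f (Htens g h) = Htens (Htens f g) h.
Proof.
elim/clsW: f => f; elim/clsW: g => g; elim/clsW: h => h.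
rewrite -(cls_tens g h) -(cls_tens f g) -(cls_tens f (t_tens g h)).
rewrite -(cls_tens (t_tens f g) h); apply/clsP.
by have := ax_tensA f g h; rewrite tm_cast_id.
Qed.
Lemma assoc21 u v (f : Hhom [:: i; i] [:: i; i]) (g : Hhom [:: i] [:: i])
    (h : Hhom u v) :
  Htens f (Htens g h) = Htens (Htens f g) h.
Proof.
elim/clsW: f => f; elim/clsW: g => g; elim/clsW: h => h.
rewrite -(cls_tens g h) -(cls_tens f g) -(cls_tens f (t_tens g h)).
rewrite -(cls_tens (t_tens f g) h); apply/clsP.
by have := ax_tensA f g h; rewrite tm_cast_id.
Qed.

Lemma cross1_comm a (f : Hhom (nseq a i) (nseq a i)) :
  cross1 a ∙ (1 ⊗ (1 ⊗ f)) = (1 ⊗ (1 ⊗ f)) ∙ cross1 a.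
Proof. by rewrite assoc11 (Htens1 [:: i] [:: i]); apply: (slide (cls (t_cross i i)) f). Qed.

Lemma dot1E a : dot1 a.+1 = Htens (Htens (cls (t_dot i)) (Hid [:: i])) (Hid (nseq a i)).
Proof. by rewrite -assoc11 (Htens1 [:: i]). Qed.
Lemma cross1E a : cross1 a.+1 = Htens (Htens (cls (t_cross i i)) (Hid [:: i])) (Hid (nseq a i)).
Proof. by rewrite -assoc21 (Htens1 [:: i]). Qed.

Lemma block u v w a (g : Hhom v w) (f : Hhom u v) :
  Htens g (Hid (nseq a i)) ∙ Htens f (Hid (nseq a i)) =
  Htens (g ∙ f) (Hid (nseq a i)).
Proof. by rewrite -Htens_comp Hcomp_1m. Qed.

Lemma cross1_sq a : cross1 a ∙ cross1 a = 0.
Proof.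
pose t := cls (t_cross i i).
transitivity (Htens (t ∙ t) (Hid (nseq a i))); first exact: (block a t t).
rewrite -(cls_comp (t_cross i i)); have /clsP -> := ax_sq_eq i; rewrite cls0.
exact: (@tens0r [:: i; i] [:: i; i] _ _ (Hid (nseq a i))).
Qed.

Lemma cross1_dot a :
  cross1 a ∙ dot1 a.+1 = (1 ⊗ dot1 a) ∙ cross1 a + Hid _.
Proof.
rewrite dot1E /dot1 assoc11.
pose t := cls (t_cross i i); pose x := cls (t_dot i); pose I := Hid [:: i].
pose tx : Hhom [:: i; i] [:: i; i] := t ∙ Htens x I.
pose xt : Hhom [:: i; i] [:: i; i] := Htens I x ∙ t.
have E : tx = xt + Hid [:: i; i].
  apply/eqP; rewrite addrC -subr_eq; apply/eqP; rewrite /tx /xt.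
  rewrite -(cls_tens (t_dot i) (t_id _)) -(cls_tens (t_id _) (t_dot i)).
  rewrite -(cls_comp (t_cross i i)) -(cls_comp _ (t_cross i i)) -clsN -clsD.
  by apply/clsP; apply: ax_nil_l.
transitivity (Htens tx (Hid (nseq a i))); first exact: (block a t (Htens x I)).
rewrite E HtensDl (Htens1 [:: i; i]); congr (_ + _).
exact: esym (block a (Htens I x) t).
Qed.

Lemma cross1_braid a :
  cross1 a.+1 ∙ (1 ⊗ cross1 a) ∙ cross1 a.+1 =
  (1 ⊗ cross1 a) ∙ cross1 a.+1 ∙ (1 ⊗ cross1 a).
Proof.
rewrite cross1E /cross1 assoc12.
pose s : tm [:: i; i; i] [:: i; i; i] := t_tens (t_cross i i) (t_id [:: i]).
pose t : tm [:: i; i; i] [:: i; i; i] := t_tens (t_id [:: i]) (t_cross i i).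
have E : cls s ∙ cls t ∙ cls s = cls t ∙ cls s ∙ cls t.
  apply/eqP; rewrite -subr_eq0; apply/eqP.
  rewrite -(cls_comp s t) -(cls_comp t s) -(cls_comp _ s) -(cls_comp _ t).
  rewrite -clsN -clsD -cls0; apply/clsP; apply: ax_braid.
  by case.
have b3 (f g h : Hhom [:: i; i; i] [:: i; i; i]) :
    Htens f (Hid (nseq a i)) ∙ Htens g (Hid (nseq a i)) ∙ Htens h (Hid (nseq a i))
    = Htens (f ∙ g ∙ h) (Hid (nseq a i)) by rewrite !block.
have -> : Htens (cls (t_cross i i)) (Hid [:: i]) = cls s.
  exact: esym (cls_tens (t_cross i i) (t_id [:: i])).
have -> : Htens (Hid [:: i]) (cls (t_cross i i)) = cls t.
  exact: esym (cls_tens (t_id [:: i]) (t_cross i i)).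
by etransitivity; [exact: b3 | rewrite E; exact: esym (b3 _ _ _)].
Qed.

(* [killed a m Y]: the crossings of the last [a] strands annihilate [Y]. *)
Definition killed : forall (a m : nat) w, Hhom w (padw m (nseq a i)) -> Prop :=
  fix killed a m w {struct a} :=
    match a return Hhom w (padw m (nseq a i)) -> Prop with
    | 0 => fun=> True
    | a'.+1 => fun Y =>
        match a' return (forall m, Hhom w (padw m (nseq a' i)) -> Prop) ->
                        Hhom w (padw m (nseq a'.+1 i)) -> Prop with
        | 0 => fun _ _ => True
        | b.+1 => fun kl Y => pad m (cross1 b) ∙ Y = 0 /\ kl m.+1 Y
        end (fun m => killed a' m w) Y
    end.

Lemma killedS a m w (Y : Hhom w (padw m (nseq a.+1 i))) :
  killed Y -> @killed a m.+1 w Y.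
Proof. by case: a Y => //= a Y []. Qed.

Lemma crosses_dot a m w (Y : Hhom w (padw m (nseq a.+1 i))) j :
  killed Y -> (j <= a)%N ->
  pad m (crosses a ∙ dot1X a j) ∙ Y = if j == a then Y else 0.
Proof.
elim: a m Y j => [|a IH] m Y j kY ja.
  by case: j ja => //= _; rewrite Hcomp_1m pad1 Hcomp_1m.
have E : cross1 a ∙ dot1X a.+1 j =
    \sum_(l < j) (1 ⊗ dot1X a l) ∙ dot1X a.+1 (j - l.+1)
      + (1 ⊗ dot1X a j) ∙ cross1 a.
  elim: {ja} j => [|j IHj].
    by rewrite big_ord0 add0r /= (Htens1 [:: i]) Hcomp_1m Hcomp_m1.
  rewrite [dot1X _ j.+1]/= Hcomp_A cross1_dot Hcomp_Dl Hcomp_1m -Hcomp_A IHj.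
  rewrite Hcomp_Dr Hcomp_A -tensl_comp big_ord_recl /= subn1 /=.
  rewrite (Htens1 [:: i]) Hcomp_1m Hcomp_sumr addrC addrA; congr (_ + _ + _).
  by apply: eq_bigr => l _; rewrite /= Hcomp_A -tensl_comp.
have [kY1 kY2] := kY.
rewrite [crosses _]/= -Hcomp_A E Hcomp_Dr Hcomp_sumr padD Hcomp_Dl.
have -> : pad m ((1 ⊗ crosses a) ∙ ((1 ⊗ dot1X a j) ∙ cross1 a)) ∙ Y = 0.
  by rewrite !pad_comp -!Hcomp_A kY1 !Hcompm0.
rewrite addr0.
rewrite (big_morph _ (@padD m _ _) (@pad0 m _ _)) Hcomp_suml /=.
have F l : (l < j)%N ->
    pad m ((1 ⊗ crosses a) ∙ ((1 ⊗ dot1X a l) ∙ dot1X a.+1 (j - l.+1))) ∙ Y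
    = if l == a then Y else 0.
  move=> lj; rewrite Hcomp_A -tensl_comp -dot1X_comm pad_comp -Hcomp_A padE.
  rewrite (IH m.+1 Y l kY2); last by rewrite -ltnS (leq_trans lj).
  case: eqP => [la|_]; last by rewrite Hcompm0.
  have -> : (j - l.+1 = 0)%N by apply/eqP; rewrite la subn_eq0.
  by rewrite pad1 Hcomp_1m.
under eq_bigr => l _ do rewrite F //.
case: (eqVneq j a.+1) => [->|ne].
  rewrite (bigD1 ord_max) //= eqxx big1 ?addr0 // => l nl.
  by rewrite ifN //; apply: contraNneq nl => la; apply/eqP/val_inj.
rewrite big1 // => l _; rewrite ifN // neq_ltn (leq_trans (ltn_ord l)) //.
by rewrite -ltnS ltn_neqAle ne.
Qed.

Lemma longest_delta a m w (Y : Hhom w (padw m (nseq a i))) :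
  killed Y -> pad m (longest a ∙ delta a) ∙ Y = Y.
Proof.
elim: a m Y => [|a IH] m Y kY; first by rewrite /= Hcomp_1m pad1 Hcomp_1m.
have -> : longest a.+1 ∙ delta a.+1 =
    (crosses a ∙ dot1X a a) ∙ (1 ⊗ (longest a ∙ delta a)).
  rewrite /= tensl_comp !Hcomp_A; congr Hcomp.
  by rewrite -!Hcomp_A dot1X_comm.
rewrite pad_comp -Hcomp_A padE (IH m.+1 Y (killedS kY)).
by rewrite crosses_dot // eqxx.
Qed.

Lemma killed_comm a m w (P : Hhom (padw m (nseq a i)) (padw m (nseq a i)))
    (Y : Hhom w (padw m (nseq a i))) :
  (forall f, P ∙ pad m f = pad m f ∙ P) -> killed Y -> killed (P ∙ Y).
Proof.
elim: a m P Y => // -[|a] IH m P Y //= cP [Y0 kY]; split.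
  by rewrite Hcomp_A -cP -Hcomp_A Y0 Hcompm0.
by apply: (IH m.+1 P Y _ kY) => f; apply: (cP (1 ⊗ f)).
Qed.

Lemma killed_cross1 a m w (Y : Hhom w (padw m.+2 (nseq a i))) :
  killed Y -> @killed a m.+2 w (pad m (cross1 a) ∙ Y).
Proof.
apply: killed_comm => f.
by rewrite -(pad_comp m (cross1 a)) cross1_comm pad_comp.
Qed.

Lemma killed_crosses a m w (Y : Hhom w (padw m.+1 (nseq a i))) :
  killed Y -> @killed a.+1 m w (pad m (crosses a) ∙ Y).
Proof.
elim: a m Y => [|a IH] m Y kY; first by [].
rewrite [crosses _]/= pad_comp -Hcomp_A; split; last first.
  exact: (IH m.+1 (pad m (cross1 a) ∙ Y) (killed_cross1 (killedS kY))).
case: a Y kY {IH} => [|a] Y kY.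
  rewrite (Htens1 [:: i] [:: i]) pad1 Hcomp_1m Hcomp_A -pad_comp cross1_sq.
  by rewrite pad0 Hcomp0m.
have {kY} [Y0 _] := kY.
have E : cross1 a.+1 ∙ ((1 ⊗ crosses a.+1) ∙ cross1 a.+1) =
    (1 ⊗ (1 ⊗ crosses a)) ∙ ((1 ⊗ cross1 a) ∙ cross1 a.+1) ∙ (1 ⊗ cross1 a).
  transitivity ((1 ⊗ (1 ⊗ crosses a)) ∙
    (cross1 a.+1 ∙ (1 ⊗ cross1 a) ∙ cross1 a.+1)).
    have C := cross1_comm (crosses a : Hhom (nseq a.+1 i) (nseq a.+1 i)).
    by rewrite [crosses a.+1]/= tensl_comp !Hcomp_A C.
  by rewrite cross1_braid !Hcomp_A.
transitivity (pad m (cross1 a.+1 ∙ ((1 ⊗ crosses a.+1) ∙ cross1 a.+1)) ∙ Y).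
  by rewrite !pad_comp -!Hcomp_A.
rewrite E pad_comp -Hcomp_A.
by transitivity (pad m ((1 ⊗ (1 ⊗ crosses a)) ∙ ((1 ⊗ cross1 a) ∙ cross1 a.+1))
  ∙ (0 : Hhom w _)); [congr Hcomp; exact: Y0 | exact: Hcompm0].
Qed.

Lemma killed_longest a m : @killed a m _ (pad m (longest a)).
Proof.
elim: a m => [|a IH] m //; rewrite [longest _]/= pad_comp.
exact: killed_crosses (IH m.+1).
Qed.

Lemma divided_idemP a : divided_idem a ∙ divided_idem a = divided_idem a.
Proof.
rewrite /divided_idem Hcomp_A -(Hcomp_A (delta a)) -Hcomp_A.
by rewrite (longest_delta (killed_longest a 0)).
Qed.

Lemma homog_delta a : delta a \in homog (a * a.-1)%:Z.
Proof.
have dotX b k : dot1X b k \in homog (k * 2)%:Z.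
  elim: k => [|k IH]; first exact: homog_id.
  rewrite mulSn PoszD; apply: homog_comp IH.
  exact: (homog_tens (homog_cls (deg_dot i)) (homog_id (nseq b i))).
elim: a => [|a IH]; first exact: homog_id.
have -> : (a.+1 * a.+1.-1)%:Z = (a * 2)%:Z + (0 + (a * a.-1)%:Z) :> int.
  by rewrite add0r -PoszD; congr Posz; case: a {IH} => //= a; rewrite -mulnDr mulnC.
by apply: homog_comp; [exact: dotX | exact: (homog_tens (homog_id [:: i]) IH)].
Qed.

Lemma homog_longest a : longest a \in homog (- (a * a.-1)%:Z).
Proof.
have cr b : crosses b \in homog (- (b * 2)%:Z).
  elim: b => [|b IH]; first exact: homog_id.
  have -> : - (b.+1 * 2)%:Z = (0 + - (b * 2)%:Z) + (- 2 + 0) :> int.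
    by rewrite add0r addr0 mulSn addnC PoszD opprD.
  apply: homog_comp; first exact: (homog_tens (homog_id [:: i]) IH).
  have ii : pairing i i = 2 by case: (i).
  rewrite -ii; exact: (homog_tens (homog_cls (deg_cross i i)) (homog_id (nseq b i))).
elim: a => [|a IH]; first exact: homog_id.
have -> : - (a.+1 * a.+1.-1)%:Z = - (a * 2)%:Z + (0 - (a * a.-1)%:Z) :> int.
  rewrite add0r -opprD -PoszD; congr (- Posz _).
  by case: a {IH} => //= a; rewrite -mulnDr mulnC.
by apply: homog_comp; [exact: cr | exact: (homog_tens (homog_id [:: i]) IH)].
Qed.

Lemma homog_divided_idem a : divided_idem a \in homog 0.
Proof. by rewrite -(subrr (a * a.-1)%:Z); apply: homog_comp; [exact: homog_delta | exact: homog_longest]. Qed.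

Definition Epow a : U := Family (fun _ : unit => (nseq a i, 0) : Scat).

Definition Epow_idem a : hom (Epow a) (Epow a) :=
  fun _ _ => @SHom (nseq a i, 0) (nseq a i, 0) _ (homog_divided_idem a).
Arguments Epow_idem a : clear implicits.

Fact Epow_idemP a : Epow_idem a ∘ Epow_idem a = Epow_idem a.
Proof.
apply: matP => -[] []; rewrite /= /matM (bigD1 tt) //= big1 ?addr0; last by case.
by apply: val_inj; apply: divided_idemP.
Qed.

Definition Ediv a : Udot :=
  kshift (- ((a * a.-1)./2)%:Z) (KObj (Epow_idemP a)).

End DividedPowers.

(* E_i^(a) E_j^(b) E_i^(c) {t}, where {i, j} = {1, 2} *)
Definition Etriple (i : node) (a b c : nat) (t : int) : Udot :=
  kshift t (Ediv i a ⊗ Ediv (other i) b ⊗ Ediv i c)%udot.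

(* Main.v *)
(** Idea. Write N(k) = k(k-1)/2, and let u be the word of E_i^(a) E_j^(b) E_i^(c),
    N = N(a) + N(b) + N(c), D and δ the tensor products of the three longest
    crossings and of the three staircase monomials, so that e = δD cuts out the
    object. If f : (u, e) -> (u', e') has degree d, then f = δ'(D'f), and D'f lies
    in degree d - N - N' of Hom(u, u').

    Hom(u, v) is spanned by dotted permutation diagrams (drag the first strand
    out and recurse on the other strands). Counting crossings, a diagram from u to
    u' has degree at least -N - N' plus a nonnegative defect; the defect vanishes
    only if the triples agree, or are exchanged by the stated isomorphism, and in
    the first case D is the only diagram of that degree. Hence the degree 0
    endomorphisms are Zid, and the defects forbid all other isomorphisms.

    Demazure operators on functions show that id has infinite order, so that the
    endomorphism ring is Z and the object is indecomposable. They also settle the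
    isomorphism: the composites of two explicit degree 0 maps are multiples of id,
    and the multiplier is read off by applying the maps to the constant function
    1, which gives a sign. *)

From mathcomp Require Import all_boot all_order all_algebra.
From mathcomp Require Import boolp zify ring.
Require Import Defs.

Set Implicit Arguments.
Unset Strict Implicit.
Unset Printing Implicit Defensive.

Import Order.TTheory GRing.Theory Num.Theory.
Local Open Scope ring_scope.
Local Open Scope cat_scope.

Local Notation "g ∙ f" := (Hcomp g f) (at level 40, left associativity).

(** * Local relations *)

(** Padding adds one letter by cons, so that padded maps compose without transport along
    associativity of [++]. *)
Definition lpad j u v (f : Hhom u v) : Hhom (j :: u) (j :: v) :=
  Htens (Hid [:: j]) f.
Definition dotl j w : Hhom (j :: w) (j :: w) := Htens (cls (t_dot j)) (Hid w).
Definition crossl i j w : Hhom [:: i, j & w] [:: j, i & w] :=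
  Htens (cls (t_cross i j)) (Hid w).

Lemma cast_eq u v (eu : u = u) (ev : v = v) (f : tm u v) :
  tm_cast eu ev f = f.
Proof. by rewrite (Prop_irrelevance eu erefl) (Prop_irrelevance ev erefl). Qed.

Lemma lpad_comp j u v w (g : Hhom v w) (f : Hhom u v) :
  lpad j (g ∙ f) = lpad j g ∙ lpad j f.
Proof. exact: tensl_comp. Qed.

Lemma lpad_id j w : lpad j (Hid w) = Hid (j :: w).
Proof. exact: (Htens1 [:: j] w). Qed.

Lemma lpadD j u v (f g : Hhom u v) : lpad j (f + g) = lpad j f + lpad j g.
Proof. exact: (HtensDr (Hid [:: j]) f g). Qed.

Lemma lpad0 j u v : lpad j (0 : Hhom u v) = 0.
Proof. by apply: (@addrI _ (lpad j 0)); rewrite -lpadD !addr0. Qed.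

Lemma lpadN j u v (f : Hhom u v) : lpad j (- f) = - lpad j f.
Proof. by apply: (@addrI _ (lpad j f)); rewrite -lpadD !subrr lpad0. Qed.

Lemma dotl_lpad j u v (f : Hhom u v) :
  dotl j v ∙ lpad j f = lpad j f ∙ dotl j u.
Proof. exact: (slide (cls (t_dot j)) f). Qed.

(** The associativity axiom carries a cast; with a one-letter word on the left both bracketings are
    convertible and the cast is trivial. *)
Lemma tensA_word1 j u v u' v' (f : Hhom [:: j] [:: j]) (g : Hhom u v) (h : Hhom u' v') :
  Htens f (Htens g h) = Htens (Htens f g) h.
Proof.
elim/clsW: f => f; elim/clsW: g => g; elim/clsW: h => h.
rewrite -(cls_tens g h) -(cls_tens f g) -(cls_tens f (t_tens g h)).
rewrite -(cls_tens (t_tens f g) h); apply/clsP.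
by have := ax_tensA f g h; rewrite cast_eq.
Qed.

Lemma tensA_word2 i j u v u' v' (f : Hhom [:: i; j] [:: j; i]) (g : Hhom u v) (h : Hhom u' v') :
  Htens f (Htens g h) = Htens (Htens f g) h.
Proof.
elim/clsW: f => f; elim/clsW: g => g; elim/clsW: h => h.
rewrite -(cls_tens g h) -(cls_tens f g) -(cls_tens f (t_tens g h)).
rewrite -(cls_tens (t_tens f g) h); apply/clsP.
by have := ax_tensA f g h; rewrite cast_eq.
Qed.

Lemma lpad_lpad i j u v (f : Hhom u v) :
  lpad i (lpad j f) = Htens (Hid [:: i; j]) f.
Proof.
by rewrite -(Htens1 [:: i] [:: j]); exact: (tensA_word1 (Hid [:: i]) (Hid [:: j]) f).
Qed.

Lemma crossl_lpad i j u v (f : Hhom u v) :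
  crossl i j v ∙ lpad i (lpad j f) = lpad j (lpad i f) ∙ crossl i j u.
Proof. by rewrite !lpad_lpad; apply: (slide (cls (t_cross i j)) f). Qed.

Definition rpad w u v (f : Hhom u v) : Hhom (u ++ w) (v ++ w) := Htens f (Hid w).

Lemma rpad_comp r u v w (g : Hhom v w) (f : Hhom u v) :
  rpad r (g ∙ f) = rpad r g ∙ rpad r f.
Proof. by rewrite /rpad -Htens_comp Hcomp_1m. Qed.

Lemma rpad_id r w : rpad r (Hid w) = Hid (w ++ r).
Proof. exact: (Htens1 w r). Qed.

Lemma rpadD r u v (f g : Hhom u v) : rpad r (f + g) = rpad r f + rpad r g.
Proof. exact: (HtensDl f g (Hid r)). Qed.

Lemma rpad0 r u v : rpad r (0 : Hhom u v) = 0.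
Proof. by apply: (@addrI _ (rpad r 0)); rewrite -rpadD !addr0. Qed.

Lemma rpadN r u v (f : Hhom u v) : rpad r (- f) = - rpad r f.
Proof. by apply: (@addrI _ (rpad r f)); rewrite -rpadD !subrr rpad0. Qed.

Lemma rpad_lpad r j u v (f : Hhom u v) : rpad r (lpad j f) = lpad j (rpad r f).
Proof. exact: esym (tensA_word1 (Hid [:: j]) f (Hid r)). Qed.

Lemma rpad_dotl r j w : rpad r (dotl j w) = dotl j (w ++ r).
Proof. by rewrite /rpad /dotl -(tensA_word1 _ (Hid w) (Hid r)) Htens1. Qed.

Lemma rpad_crossl r i j w : rpad r (crossl i j w) = crossl i j (w ++ r).
Proof. by rewrite /rpad /crossl -(tensA_word2 _ (Hid w) (Hid r)) Htens1. Qed.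

Local Notation xdot i := (cls (t_dot i)).
Local Notation xcross i j := (cls (t_cross i j)).

(** The defining relation on two strands, [E], is extended by identity strands on the right through
    [rpad w]; the relations below follow the same pattern. *)
Lemma crossl_nil_l i w :
  crossl i i w ∙ dotl i (i :: w) = lpad i (dotl i w) ∙ crossl i i w + Hid _.
Proof.
have E : xcross i i ∙ rpad [:: i] (xdot i) = lpad i (xdot i) ∙ xcross i i + Hid [:: i; i].
  apply/eqP; rewrite addrC -subr_eq; apply/eqP.
  rewrite /rpad /lpad -(cls_tens (t_dot i) (t_id [:: i])).
  rewrite -(cls_tens (t_id [:: i]) (t_dot i)) -(cls_comp (t_cross i i)).
  by rewrite -(cls_comp _ (t_cross i i)) -clsN -clsD; apply/clsP/ax_nil_l.
have := congr1 (@rpad w _ _) E.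
by rewrite rpadD !rpad_comp rpad_id rpad_lpad (rpad_dotl w i [:: i]).
Qed.

Lemma crossl_nil_r i w :
  dotl i (i :: w) ∙ crossl i i w = crossl i i w ∙ lpad i (dotl i w) + Hid _.
Proof.
have E : rpad [:: i] (xdot i) ∙ xcross i i = xcross i i ∙ lpad i (xdot i) + Hid [:: i; i].
  apply/eqP; rewrite addrC -subr_eq; apply/eqP.
  rewrite /rpad /lpad -(cls_tens (t_dot i) (t_id [:: i])).
  rewrite -(cls_tens (t_id [:: i]) (t_dot i)) -(cls_comp (t_cross i i)).
  by rewrite -(cls_comp _ (t_cross i i)) -clsN -clsD; apply/clsP/ax_nil_r.
have := congr1 (@rpad w _ _) E.
by rewrite rpadD !rpad_comp rpad_id rpad_lpad (rpad_dotl w i [:: i]).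
Qed.

Lemma crossl_sq_eq i w : crossl i i w ∙ crossl i i w = 0.
Proof.
have E : xcross i i ∙ xcross i i = 0.
  by rewrite -(cls_comp (t_cross i i)) -cls0; apply/clsP/ax_sq_eq.
by have := congr1 (@rpad w _ _) E; rewrite rpad0 !rpad_comp.
Qed.

Lemma crossl_sq_neq i j w : i <> j ->
  crossl j i w ∙ crossl i j w = dotl i (j :: w) + lpad i (dotl j w).
Proof.
move=> ij.
have E : xcross j i ∙ xcross i j = rpad [:: j] (xdot i) + lpad i (xdot j).
  rewrite /rpad /lpad -(cls_tens (t_dot i) (t_id [:: j])).
  rewrite -(cls_tens (t_id [:: i]) (t_dot j)) -(cls_comp (t_cross j i)).
  by rewrite -clsD; apply/clsP/ax_sq_neq.
have := congr1 (@rpad w _ _) E.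
by rewrite rpadD !rpad_comp rpad_lpad (rpad_dotl w i [:: j]).
Qed.

Lemma crossl_slide_l i j w : i <> j ->
  dotl j (i :: w) ∙ crossl i j w = crossl i j w ∙ lpad i (dotl j w).
Proof.
move=> ij.
have E : rpad [:: i] (xdot j) ∙ xcross i j = xcross i j ∙ lpad i (xdot j).
  rewrite /rpad /lpad -(cls_tens (t_dot j) (t_id [:: i])).
  rewrite -(cls_tens (t_id [:: i]) (t_dot j)) -(cls_comp (t_cross i j)).
  by rewrite -(cls_comp _ (t_cross i j)); apply/clsP/ax_slide_l.
have := congr1 (@rpad w _ _) E.
by rewrite !rpad_comp rpad_lpad (rpad_dotl w j [:: i]).
Qed.

Lemma crossl_slide_r i j w : i <> j ->
  lpad j (dotl i w) ∙ crossl i j w = crossl i j w ∙ dotl i (j :: w).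
Proof.
move=> ij.
have E : lpad j (xdot i) ∙ xcross i j = xcross i j ∙ rpad [:: j] (xdot i).
  rewrite /rpad /lpad -(cls_tens (t_dot i) (t_id [:: j])).
  rewrite -(cls_tens (t_id [:: j]) (t_dot i)) -(cls_comp (t_cross i j)).
  by rewrite -(cls_comp _ (t_cross i j)); apply/clsP/ax_slide_r.
have := congr1 (@rpad w _ _) E.
by rewrite !rpad_comp rpad_lpad (rpad_dotl w i [:: j]).
Qed.

Lemma crossl_braid_iji i j w : i <> j ->
  crossl j i (i :: w) ∙ lpad j (crossl i i w) ∙ crossl i j (i :: w)
  = lpad i (crossl i j w) ∙ crossl i i (j :: w) ∙ lpad i (crossl j i w)
    + Hid [:: i, j, i & w].
Proof.
move=> ij.
have E : rpad [:: i] (xcross j i) ∙ lpad j (xcross i i) ∙ rpad [:: i] (xcross i j)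
    = lpad i (xcross i j) ∙ rpad [:: j] (xcross i i) ∙ lpad i (xcross j i) + Hid [:: i; j; i].
  apply/eqP; rewrite addrC -subr_eq; apply/eqP.
  have := ax_braid_iji ij => /clsP; rewrite clsD clsN !cls_comp.
  rewrite !(cls_tens (t_cross _ _) (t_id _)) (cls_tens (t_id _) (t_cross i j)).
  rewrite (cls_tens (t_id _) (t_cross i i)).
  by rewrite (cls_tens (t_id [:: i]) (t_cross j i)).
have := congr1 (@rpad w _ _) E.
rewrite rpadD !rpad_comp rpad_id !rpad_lpad.
by rewrite !(rpad_crossl w _ _ [:: _]).
Qed.

Lemma crossl_braid i j k w : ~ (i = k /\ i <> j) ->
  crossl j k (i :: w) ∙ lpad j (crossl i k w) ∙ crossl i j (k :: w)
  = lpad k (crossl i j w) ∙ crossl i k (j :: w) ∙ lpad i (crossl j k w).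
Proof.
move=> ijk.
have E : rpad [:: i] (xcross j k) ∙ lpad j (xcross i k) ∙ rpad [:: k] (xcross i j)
    = lpad k (xcross i j) ∙ rpad [:: j] (xcross i k) ∙ lpad i (xcross j k).
  apply/eqP; rewrite -subr_eq0; apply/eqP.
  have := ax_braid ijk => /clsP; rewrite clsD clsN cls0 !cls_comp.
  rewrite !(cls_tens (t_cross _ _) (t_id _)) (cls_tens (t_id _) (t_cross i j)).
  by rewrite (cls_tens (t_id [:: j]) (t_cross i k)) (cls_tens (t_id [:: i]) (t_cross j k)).
have := congr1 (@rpad w _ _) E.
rewrite !rpad_comp !rpad_lpad.
by rewrite !(rpad_crossl w _ _ [:: _]).
Qed.

(** * Spanning by normal forms *)

Section Span.
Variables (V : zmodType) (P : V -> Prop).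

Inductive span : V -> Prop :=
| span0 : span 0
| span_in x : P x -> span x
| spanD x y : span x -> span y -> span (x + y)
| spanN x : span x -> span (- x).
End Span.

Lemma span_bind (V W : zmodType) (P : V -> Prop) (Q : W -> Prop) (f : V -> W) :
  f 0 = 0 -> {morph f : x y / x + y} -> (forall x, P x -> span Q (f x)) ->
  forall x, span P x -> span Q (f x).
Proof.
move=> f0 fD PQ x; elim=> [|{}x|{}x y _ IHx _ IHy|{}x _ IHx].
- by rewrite f0; apply: span0.
- exact: PQ.
- by rewrite fD; apply: spanD.
- have -> : f (- x) = - f x by apply: (@addrI _ (f x)); rewrite -fD !subrr.
  exact: spanN.
Qed.

(** * Homogeneous maps as combinations of composites of padded generators *)

Inductive gen : forall v w, int -> Hhom v w -> Prop :=
| gen_dot i v : gen 2 (dotl i v)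
| gen_cross i j v : gen (- pairing i j) (crossl i j v)
| gen_lpad j v w d (g : Hhom v w) : gen d g -> gen d (lpad j g).

(** Tensor products are absent: to normalise a map it then suffices to know how a single padded
    generator meets a normal form. *)
Inductive alg : forall v w, int -> Hhom v w -> Prop :=
| alg_gen v w d (g : Hhom v w) : gen d g -> alg d g
| alg_id v : alg 0 (Hid v)
| alg_comp u v w d d' (g : Hhom v w) (f : Hhom u v) :
    alg d g -> alg d' f -> alg (d + d') (g ∙ f)
| alg_0 v w d : alg d (0 : Hhom v w)
| alg_add v w d (g f : Hhom v w) : alg d g -> alg d f -> alg d (g + f)
| alg_opp v w d (g : Hhom v w) : alg d g -> alg d (- g).

Lemma alg_lpad j v w d (g : Hhom v w) : alg d g -> alg d (lpad j g).
Proof.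
elim=> {v w d g} [v w d g|v|u v w d d' g f _ IHg _ IHf|v w d|v w d g f _ IHg _ IHf|v w d g _ IHg].
- by move=> /(gen_lpad j); apply: alg_gen.
- by rewrite lpad_id; apply: alg_id.
- by rewrite lpad_comp; apply: alg_comp.
- by rewrite lpad0; apply: alg_0.
- by rewrite lpadD; apply: alg_add.
- by rewrite lpadN; apply: alg_opp.
Qed.

Lemma gen_rpad r v w d (g : Hhom v w) : gen d g -> gen d (rpad r g).
Proof.
elim=> {v w d g} [i v|i j v|j v w d g _ IH].
- by rewrite rpad_dotl; apply: gen_dot.
- by rewrite rpad_crossl; apply: gen_cross.
- by rewrite rpad_lpad; apply: gen_lpad.
Qed.

Lemma alg_rpad r v w d (g : Hhom v w) : alg d g -> alg d (rpad r g).
Proof.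
elim=> {v w d g} [v w d g|v|u v w d d' g f _ IHg _ IHf|v w d|v w d g f _ IHg _ IHf|v w d g _ IHg].
- by move=> /(gen_rpad r); apply: alg_gen.
- by rewrite rpad_id; apply: alg_id.
- by rewrite rpad_comp; apply: alg_comp.
- by rewrite rpad0; apply: alg_0.
- by rewrite rpadD; apply: alg_add.
- by rewrite rpadN; apply: alg_opp.
Qed.

Lemma tens_unitl u v (f : Hhom u v) : Htens (Hid [::]) f = f.
Proof.
by elim/clsW: f => f; rewrite -(cls_tens (t_id [::]) f); apply/clsP/ax_tens1m.
Qed.

Lemma cls_unitr u v (f : tm u v) :
  cls (tm_cast (cats0 u) (cats0 v) (t_tens f (t_id [::]))) = cls f.
Proof. by apply/clsP/ax_tensm1. Qed.

Lemma alg_tensl p v w d (g : Hhom v w) : alg d g -> alg d (Htens (Hid p) g).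
Proof.
move=> ag; elim: p => [|j p IH]; first by rewrite tens_unitl.
rewrite -(Htens1 [:: j] p) -(tensA_word1 (Hid [:: j]) (Hid p) g).
exact: alg_lpad.
Qed.

(** The interchange law; it removes tensor products from expressions in [homog_alg]. *)
Lemma tens_split u v u' v' (f : Hhom u v) (f' : Hhom u' v') :
  Htens f f' = rpad v' f ∙ Htens (Hid u) f'.
Proof. by rewrite -Htens_comp Hcomp_1m Hcomp_m1. Qed.

Lemma cls_dot_alg i : alg 2 (cls (t_dot i)).
Proof.
rewrite -(cls_unitr (t_dot i)) cast_eq (cls_tens (t_dot i) (t_id [::])).
exact: alg_gen (gen_dot i [::]).
Qed.

Lemma cls_cross_alg i j : alg (- pairing i j) (cls (t_cross i j)).
Proof.
rewrite -(cls_unitr (t_cross i j)) cast_eq (cls_tens (t_cross i j) (t_id [::])).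
exact: alg_gen (gen_cross i j [::]).
Qed.

Lemma homog_alg u v d (f : Hhom u v) : f \in homog d -> alg d f.
Proof.
move=> /asboolP[t <- {f}].
elim=> {u v d t} [u|i|i j|u v w g f d d' _ IHg _ IHf|u v u' v' f f' d d' _ IHf _ IHf'
  |u v d|u v f g d _ IHf _ IHg|u v f d _ IHf].
- exact: alg_id.
- exact: cls_dot_alg.
- exact: cls_cross_alg.
- by rewrite cls_comp; apply: alg_comp.
- rewrite cls_tens tens_split; apply: alg_comp; first exact: alg_rpad.
  exact: alg_tensl.
- exact: alg_0.
- by rewrite clsD; apply: alg_add.
- by rewrite clsN; apply: alg_opp.
Qed.

(** * Normal forms: the first strand is dragged out to its endpoint *)

Fixpoint pass i v1 v2 : Hhom (i :: (v1 ++ v2)) (v1 ++ i :: v2) :=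
  match v1 with
  | [::] => Hid (i :: v2)
  | j :: v1' => lpad j (pass i v1' v2) ∙ crossl i j (v1' ++ v2)
  end.

Fixpoint pass_deg i (v : word) : int :=
  if v is j :: v' then pass_deg i v' - pairing i j else 0.

Definition dotX i w k : Hhom (i :: w) (i :: w) :=
  iter k (Hcomp (dotl i w)) (Hid _).

Inductive nf_nil : forall v, int -> Hhom [::] v -> Prop :=
  Nf_nil : nf_nil 0 (Hid [::]).

(** The condition [S] on the diagram of the other strands is a parameter: [nform] for normal forms
    proper, [alg] while that factor is not yet normalised. *)
Inductive nf_cons i u (S : forall v, int -> Hhom u v -> Prop) :
    forall v, int -> Hhom (i :: u) v -> Prop :=
  Nf_cons v1 v2 k d h D : S (v1 ++ v2) d h -> D = pass_deg i v1 + (k.*2)%:Z + d ->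
    nf_cons S D (pass i v1 v2 ∙ (dotX i (v1 ++ v2) k ∙ lpad i h)).

(* In a normal form the diagram [h] of the other strands is drawn first, at the
   bottom; then come the dots of the first strand, then its crossings. *)
Fixpoint nform u : forall v, int -> Hhom u v -> Prop :=
  match u with
  | [::] => fun v d => span (@nf_nil v d)
  | i :: u' => fun v d => span (@nf_cons i u' (@nform u') v d)
  end.

Definition on_cross i v : (forall w, int -> Hhom (i :: v) w -> Prop) -> Prop :=
  match v with
  | [::] => fun _ => True
  | j :: v' => fun Q => Q _ (- pairing i j) (crossl i j v')
  end.

(* Quantification over the generators with source [v], by recursion on [v]: it
   computes when [v] is [v1 ++ i :: v2], so that no transport is needed. *)
Fixpoint on_gens v : (forall w, int -> Hhom v w -> Prop) -> Prop :=
  match v with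
  | [::] => fun _ => True
  | i :: v' => fun Q => [/\ Q _ 2 (dotl i v'), on_cross Q
                & on_gens (fun w d g => Q (i :: w) d (lpad i g))]
  end.

Lemma on_gens_impl v (Q Q' : forall w, int -> Hhom v w -> Prop) :
  (forall w d g, Q w d g -> Q' w d g) -> on_gens Q -> on_gens Q'.
Proof.
elim: v Q Q' => //= i v IH Q Q' QQ' [Q1 Q2 Q3]; split; first exact: QQ'.
  by case: v {Q1 Q3 IH} Q Q' QQ' Q2 => //= j v Q Q' QQ'; apply: QQ'.
by apply: IH Q3 => w d g; apply: QQ'.
Qed.

Lemma on_gensP v (Q : forall w, int -> Hhom v w -> Prop) w d (g : Hhom v w) :
  gen d g -> on_gens Q -> Q w d g.
Proof.
move=> ge; elim: ge Q => {v w d g} [i v|i j v|j v w d g _ IH] Q /= [] //.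
by move=> _ _; apply: IH.
Qed.

Lemma on_gensT v (Q : forall w, int -> Hhom v w -> Prop) :
  (forall w d g, gen d g -> Q w d g) -> on_gens Q.
Proof.
elim: v Q => //= i v IH Q GQ; split; first exact/GQ/gen_dot.
  by case: v {IH} Q GQ => //= j v Q GQ; apply/GQ/gen_cross.
by apply: IH => w d g ge; apply/GQ/gen_lpad.
Qed.

Lemma alg_eq v w d d' (g : Hhom v w) : alg d g -> d = d' -> alg d' g.
Proof. by move=> ag <-. Qed.

Lemma alg_pass i v1 v2 : alg (pass_deg i v1) (pass i v1 v2).
Proof.
elim: v1 => [|j v1 IH] /=; first exact: alg_id.
by apply: alg_comp; [apply: alg_lpad | apply/alg_gen/gen_cross].
Qed.

Lemma alg_dotX i w k : alg (k.*2)%:Z (dotX i w k).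
Proof.
elim: k => [|k IH] /=; first exact: alg_id.
by apply: alg_eq (alg_comp (alg_gen (gen_dot _ _)) IH) _; lia.
Qed.

Lemma dotX_lpad i u v k (f : Hhom u v) : dotX i v k ∙ lpad i f = lpad i f ∙ dotX i u k.
Proof.
elim: k => [|k IH] /=; first by rewrite Hcomp_1m Hcomp_m1.
by rewrite -Hcomp_A IH !Hcomp_A dotl_lpad.
Qed.

Lemma dotXD i v k l : dotX i v k ∙ dotX i v l = dotX i v (k + l).
Proof.
elim: k => [|k IH] /=; first by rewrite Hcomp_1m.
by rewrite -Hcomp_A IH.
Qed.

Lemma dotX_slide i j w k : i <> j ->
  lpad j (dotX i w k) ∙ crossl i j w = crossl i j w ∙ dotX i (j :: w) k.
Proof.
move=> ij; elim: k => [|k IH] /=; first by rewrite lpad_id Hcomp_1m Hcomp_m1.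
by rewrite lpad_comp -Hcomp_A IH !Hcomp_A crossl_slide_r.
Qed.

Lemma HcompNm u v w (g : Hhom v w) (f : Hhom u v) : (- g) ∙ f = - (g ∙ f).
Proof. exact: (@compNm Hcat). Qed.

Lemma HcompmN u v w (g : Hhom v w) (f : Hhom u v) : g ∙ (- f) = - (g ∙ f).
Proof. exact: (@compmN Hcat). Qed.

Definition dot_pair i w k (f : Hhom [:: i, i & w] [:: i, i & w]) :=
  exists s t, (s + t).+1 = k /\ f = dotX i (i :: w) s ∙ lpad i (dotX i w t).

(** Each dot sliding through a crossing of equal labels leaves an error term without crossing;
    together these are monomials with [k - 1] dots. *)
Lemma dotX_nil i w k : exists2 Y, span (@dot_pair i w k) Y &
  lpad i (dotX i w k) ∙ crossl i i w = crossl i i w ∙ dotX i (i :: w) k + Y.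
Proof.
elim: k => [|k [Y sY IH]].
  by exists 0; [apply: span0 | rewrite addr0 /= lpad_id Hcomp_1m Hcomp_m1].
exists (lpad i (dotl i w) ∙ Y - dotX i (i :: w) k).
  apply: spanD; last first.
    apply/spanN/span_in; exists k, 0%N; rewrite addn0; split=> //=.
    by rewrite lpad_id Hcomp_m1.
  move: sY; apply: (span_bind (f := Hcomp (lpad i (dotl i w)))).
  - exact: Hcompm0.
  - by move=> f g; rewrite Hcomp_Dr.
  move=> f [s [t [<- ->]]]; apply: span_in; exists s, t.+1; rewrite addnS.
  by split=> //=; rewrite Hcomp_A -dotX_lpad -Hcomp_A -lpad_comp.
rewrite /= lpad_comp -Hcomp_A IH Hcomp_Dr Hcomp_A.
have -> : lpad i (dotl i w) ∙ crossl i i w = crossl i i w ∙ dotl i (i :: w) - Hid _.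
  by rewrite crossl_nil_l addrK.
by rewrite Hcomp_Dl HcompNm Hcomp_1m -Hcomp_A addrAC addrA.
Qed.

(** The strand [i] now also crosses [j]. Its dots slide down through this crossing, and [r] slides
    below it. *)
Lemma nf_cons_lpad i j s w D D' (F : Hhom (i :: s) w) :
  nf_cons (@alg s) D F -> D' = D - pairing i j ->
  span (@nf_cons i (j :: s) (@alg (j :: s)) (j :: w) D') (lpad j F ∙ crossl i j s).
Proof.
case=> {w D F} v1 v2 k d r D ar -> ->.
rewrite !lpad_comp -!Hcomp_A -crossl_lpad.
case: (pselect (i = j)) => [<-|ij]; last first.
  rewrite (Hcomp_A (lpad j (dotX _ _ _))) dotX_slide // -Hcomp_A Hcomp_A.
  apply: span_in; apply: (@Nf_cons i (j :: s) (@alg (j :: s)) (j :: v1) v2 k d (lpad j r)).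
    exact: alg_lpad.
  by rewrite /=; ring.
have [Y sY E] := dotX_nil i (v1 ++ v2) k.
rewrite (Hcomp_A (lpad i (dotX _ _ _))) E Hcomp_Dl Hcomp_Dr -Hcomp_A Hcomp_A.
apply: spanD.
  apply: span_in; apply: (@Nf_cons i (i :: s) (@alg (i :: s)) (i :: v1) v2 k d (lpad i r)).
    exact: alg_lpad.
  by rewrite /=; ring.
pose f x := lpad i (pass i v1 v2) ∙ (x ∙ lpad i (lpad i r)).
rewrite -[_ ∙ _]/(f Y).
apply: span_bind sY.
- by rewrite /f Hcomp0m Hcompm0.
- by move=> x y; rewrite /f Hcomp_Dl Hcomp_Dr.
move=> _ [p [q [<- ->]]]; rewrite /f.
(* In the error terms that crossing is gone: the first strand stays leftmost with [p] dots, while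
   the second one, of the same label, takes over the old path with [q] dots. *)
have -> : lpad i (pass i v1 v2) ∙ (dotX i (i :: v1 ++ v2) p ∙ lpad i (dotX i (v1 ++ v2) q)
    ∙ lpad i (lpad i r)) =
  pass i [::] _ ∙ (dotX i (v1 ++ i :: v2) p ∙
     lpad i (pass i v1 v2 ∙ (dotX i (v1 ++ v2) q ∙ lpad i r))).
  by rewrite /= Hcomp_1m !lpad_comp !Hcomp_A dotX_lpad.
apply: span_in; apply: (@Nf_cons i (i :: s) (@alg (i :: s)) [::] (v1 ++ i :: v2) p _
  (pass i v1 v2 ∙ (dotX i (v1 ++ v2) q ∙ lpad i r))).
  apply: alg_comp; first exact: alg_pass.
  apply: alg_comp; [exact: alg_dotX | exact: (alg_lpad i ar)].
rewrite /= (_ : pairing i i = 2); last by case: (i).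
lia.
Qed.

(* The factors [r] absorb what slides to the bottom right of the long strand. *)
Lemma gen_pass i v1 v2 :
  on_gens (fun w d g => span (@nf_cons i (v1 ++ v2) (@alg (v1 ++ v2)) w
     (d + pass_deg i v1)) (g ∙ pass i v1 v2)).
Proof.
elim: v1 => [|j v1 IH].
  split=> /=.
  - rewrite Hcomp_m1; apply: span_in.
    have := @Nf_cons i v2 (@alg v2) [::] v2 1 0 (Hid _) _ (alg_id _) erefl.
    by rewrite /= !lpad_id !Hcomp_m1 Hcomp_1m.
  - case: v2 => //= j v2; rewrite Hcomp_m1 addr0; apply: span_in.
    have := @Nf_cons i (j :: v2) (@alg (j :: v2)) [:: j] v2 0 0 (Hid _) _ (alg_id _) erefl.
    by rewrite /= !lpad_id !Hcomp_m1 Hcomp_1m add0r !addr0.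
  - apply: on_gensT => w d g ge; rewrite Hcomp_m1 addr0; apply: span_in.
    have := @Nf_cons i v2 (@alg v2) [::] w 0 d g _ (alg_gen ge) erefl.
    by rewrite /= !Hcomp_1m add0r.
split.
(* A dot on the strand [j] slides down through its crossing with the long strand. For [i = j] the
   error term resolves the crossing: the first strand stays in place and [pass i v1 v2] becomes part
   of the factor of the other strands. *)
- rewrite [pass _ _ _]/= Hcomp_A dotl_lpad -Hcomp_A.
  case: (pselect (i = j)) => [<-|ij].
    rewrite crossl_nil_r Hcomp_Dr Hcomp_m1; apply: spanD; apply: span_in.
      have := @Nf_cons i (i :: v1 ++ v2) (@alg (i :: v1 ++ v2)) (i :: v1) v2 0 2
        (dotl i (v1 ++ v2)) _ (alg_gen (gen_dot _ _)) erefl.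
      rewrite /= Hcomp_1m Hcomp_A addr0 addrC; exact.
    have := @Nf_cons i (i :: v1 ++ v2) (@alg (i :: v1 ++ v2)) [::] (v1 ++ i :: v2) 0 
      _ (pass i v1 v2) _ (alg_pass _ _ _) erefl.
    rewrite /= !Hcomp_1m !add0r.
    by rewrite (_ : pairing i i = 2) 1?addrCA ?subrr ?addr0 //; case: (i).
  rewrite crossl_slide_l // Hcomp_A; apply: span_in.
  have := @Nf_cons i (j :: v1 ++ v2) (@alg (j :: v1 ++ v2)) (j :: v1) v2 0 2
    (dotl j (v1 ++ v2)) _ (alg_gen (gen_dot _ _)) erefl.
  rewrite /= Hcomp_1m addr0 addrC; exact.
(* The generator crosses the first two strands. This is a double crossing if [v1] is empty, and
   otherwise a triangle, which the braid relation turns so that the generator falls below the long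
   strand. *)
- case: v1 IH => [|k v1] _.
    rewrite /= lpad_id Hcomp_1m.
    case: (pselect (i = j)) => [<-|ij].
      rewrite crossl_sq_eq; exact: span0.
    rewrite crossl_sq_neq //; apply: spanD; apply: span_in.
      have := @Nf_cons i (j :: v2) (@alg (j :: v2)) [::] (j :: v2) 1 0
        (Hid _) _ (alg_id _) erefl.
      rewrite /= lpad_id Hcomp_1m !Hcomp_m1.
      by case: i j ij => -[].
    have := @Nf_cons i (j :: v2) (@alg (j :: v2)) [::] (j :: v2) 0 2
        (dotl j v2) _ (alg_gen (gen_dot _ _)) erefl.
    rewrite /= !Hcomp_1m.
    by case: i j ij => -[].
  rewrite [on_cross _]/=.
  have -> : crossl j k (v1 ++ i :: v2) ∙ pass i [:: j, k & v1] v2 =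
    lpad k (lpad j (pass i v1 v2)) ∙
    (crossl j k (i :: v1 ++ v2) ∙ lpad j (crossl i k (v1 ++ v2)) ∙ crossl i j (k :: v1 ++ v2)).
    by rewrite /= lpad_comp !Hcomp_A crossl_lpad.
  have A : span (@nf_cons i [:: j, k & v1 ++ v2] (@alg [:: j, k & v1 ++ v2])
     [:: k, j & v1 ++ i :: v2]
     (- pairing j k + pass_deg i [:: j, k & v1]))
    (lpad k (lpad j (pass i v1 v2)) ∙ (lpad k (crossl i j (v1 ++ v2)) ∙
      crossl i k (j :: v1 ++ v2) ∙ lpad i (crossl j k (v1 ++ v2)))).
    apply: span_in.
    have := @Nf_cons i [:: j, k & v1 ++ v2] (@alg [:: j, k & v1 ++ v2]) [:: k, j & v1] v2 0
      _ (crossl j k (v1 ++ v2)) _ (alg_gen (gen_cross _ _ _)) erefl.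
    rewrite /= Hcomp_1m lpad_comp !Hcomp_A.
    by congr nf_cons; lia.
  case: (pselect (i = k /\ i <> j)) => [[ik ij]|ijk]; last by rewrite crossl_braid.
  subst k; rewrite crossl_braid_iji // Hcomp_Dr Hcomp_m1; apply: spanD => //.
  apply: span_in.
  have := @Nf_cons i [:: j, i & v1 ++ v2] (@alg [:: j, i & v1 ++ v2]) [::]
      [:: j & v1 ++ i :: v2] 0 _ (lpad j (pass i v1 v2)) _
      (alg_lpad j (alg_pass _ _ _)) erefl.
  rewrite /= !Hcomp_1m !add0r.
  (* The three crossings that the correction term removes have degrees 1, -2 and 1. *)
  by have -> : - pairing j i + (pass_deg i v1 - pairing i i - pairing i j) = pass_deg i v1
    by clear -ij; case: i j ij => -[] //= _; lia.
- apply: on_gens_impl IH => w d g.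
  pose f (x : Hhom (i :: v1 ++ v2) w) := lpad j x ∙ crossl i j (v1 ++ v2).
  have -> : lpad j g ∙ pass i (j :: v1) v2 = f (g ∙ pass i v1 v2).
    by rewrite /f /= lpad_comp Hcomp_A.
  apply: span_bind.
  - by rewrite /f lpad0 Hcomp0m.
  - by move=> x y; rewrite /f lpadD Hcomp_Dl.
  by move=> x nx; apply: (nf_cons_lpad nx); rewrite /=; ring.
Qed.

Lemma nform0 u v d : nform d (0 : Hhom u v).
Proof. by case: u => *; apply: span0. Qed.
Lemma nformD u v d (f g : Hhom u v) : nform d f -> nform d g -> nform d (f + g).
Proof. by case: u f g => *; apply: spanD. Qed.
Lemma nformN u v d (f : Hhom u v) : nform d f -> nform d (- f).
Proof. by case: u f => *; apply: spanN. Qed.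

(** The two batches of dots on the first strand merge, and the factor [r ∙ h] of the other strands
    is normalised by the first hypothesis. *)
Lemma nf_cons_alg i u s w E D k d (F : Hhom (i :: s) w) (h : Hhom u s) :
  (forall v w dg d (g : Hhom v w) (h : Hhom u v),
     alg dg g -> nform d h -> nform (dg + d) (g ∙ h)) ->
  nf_cons (@alg s) E F -> nform d h -> D = E + (k.*2)%:Z + d ->
  nform D (F ∙ (dotX i s k ∙ lpad i h)).
Proof.
move=> IHu; case=> {w E F} w1 w2 l dr r E ar -> nh ->.
rewrite -!Hcomp_A (Hcomp_A (lpad i r)) -dotX_lpad.
rewrite -(Hcomp_A (dotX i (w1 ++ w2) k)) -lpad_comp (Hcomp_A (dotX _ _ l)) dotXD.
apply: span_in; apply: Nf_cons; first by apply: IHu ar nh.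
by rewrite doubleD PoszD; ring.
Qed.

(** Outer induction on the source [u], inner induction on the expression [g]. A single generator on
    a normal form is [gen_pass] followed by [nf_cons_alg]. *)
Lemma nform_alg u v w dg d (g : Hhom v w) (h : Hhom u v) :
  alg dg g -> nform d h -> nform (dg + d) (g ∙ h).
Proof.
elim: u v w dg d g h => [|i u IHu] v w dg d g h ag.
- elim: ag d h => {v w dg g}
    [v w dg g ge|v|u v w d d' g f _ IHg _ IHf|v w d|v w d g f _ IHg _ IHf|v w d g _ IHg] e h nh.
  + have: span (@nf_nil v e) h by [].
    have {nh} : v <> [::] by case: ge.
    move=> v0; elim=> [|x nx|x y _ IHx _ IHy|x _ IHx].
    * by rewrite Hcompm0; apply: span0.
    * by case: nx w dg g ge v0.
    * by rewrite Hcomp_Dr; apply: spanD.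
    * by rewrite HcompmN; apply: spanN.
  + by rewrite Hcomp_1m add0r.
  + by rewrite -Hcomp_A -addrA; apply/IHg/IHf.
  + by rewrite Hcomp0m; apply: nform0.
  + by rewrite Hcomp_Dl; apply: nformD; [apply: IHg | apply: IHf].
  + by rewrite HcompNm; apply: nformN; apply: IHg.
elim: ag d h => {v w dg g}
  [v w dg g ge|v|u' v w d d' g f _ IHg _ IHf|v w d|v w d g f _ IHg _ IHf|v w d g _ IHg] e h.
- apply: (span_bind (f := Hcomp g)).
  + exact: Hcompm0.
  + by move=> x y; rewrite Hcomp_Dr.
  move=> x nx; case: nx w dg g ge => {v e h x} v1 v2 k d h D nh -> w dg g ge.
  rewrite Hcomp_A; pose F (y : Hhom (i :: v1 ++ v2) w) := y ∙ (dotX i (v1 ++ v2) k ∙ lpad i h).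
  rewrite -[_ ∙ _]/(F (g ∙ pass i v1 v2)).
  have := on_gensP ge (gen_pass i v1 v2).
  apply: span_bind.
  + by rewrite /F Hcomp0m.
  + by move=> x y; rewrite /F Hcomp_Dl.
  move=> x nx; rewrite /F.
  by apply: (nf_cons_alg IHu nx nh); rewrite !addrA.
- by rewrite Hcomp_1m add0r.
- by move=> nh; rewrite -Hcomp_A -addrA; apply/IHg/IHf.
- by rewrite Hcomp0m => _; apply: nform0.
- by move=> nh; rewrite Hcomp_Dl; apply: nformD; [apply: IHg | apply: IHf].
- by move=> nh; rewrite HcompNm; apply: nformN; apply: IHg.
Qed.

Lemma nform_id u : nform 0 (Hid u).
Proof.
elim: u => [|i u IH]; first exact: span_in.
apply: span_in; have := @Nf_cons i u (@nform u) [::] u 0 0 (Hid u) _ IH erefl.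
by rewrite /= lpad_id !Hcomp_m1.
Qed.

(** The spanning half of the basis theorem for these quiver Hecke algebras, obtained by composing
    the map with the normal form of the identity. *)
Lemma homog_nform u v d (f : Hhom u v) : f \in homog d -> nform d f.
Proof.
by move=> /homog_alg af; have := nform_alg af (nform_id u); rewrite Hcomp_m1 addr0.
Qed.

(** * Degree bounds *)

Lemma additive_mulz (V W : zmodType) (f : V -> W) :
  {morph f : x y / x + y} -> forall x (n : int), f (x *~ n) = f x *~ n.
Proof.
move=> fD; have f0 : f 0 = 0 by apply: (@addrI _ (f 0)); rewrite -fD !addr0.
have fM x (n : nat) : f (x *+ n) = f x *+ n.
  by elim: n => [|n IH]; rewrite ?mulr0n // !mulrS fD IH.
move=> x [n|n]; first exact: fM.
by apply: (@addrI _ (f (x *+ n.+1))); rewrite -fD /= subrr f0 fM subrr.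
Qed.

Definition Hcast u v v' (e : v = v') (f : Hhom u v) : Hhom u v' :=
  eq_rect v (Hhom u) f v' e.

Lemma Hcast_id u v (e : v = v) (f : Hhom u v) : Hcast e f = f.
Proof. by rewrite (Prop_irrelevance e erefl). Qed.

Lemma Hcast_lpad j u v v' (e : v = v') (e' : j :: v = j :: v') (f : Hhom u v) :
  Hcast e' (lpad j f) = lpad j (Hcast e f).
Proof. by case: v' / e e' => e'; rewrite Hcast_id. Qed.

Lemma Hcast_comp u v w w' (e : w = w') (g : Hhom v w) (f : Hhom u v) :
  Hcast e (g ∙ f) = Hcast e g ∙ f.
Proof. by case: w' / e. Qed.

Definition vanish_below u v (m : int) :=
  forall d (f : Hhom u v), nform d f -> d < m -> f = 0.

Definition cyclic_at u v (m : int) (g : Hhom u v) :=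
  forall f : Hhom u v, nform m f -> exists n : int, f = g *~ n.

Lemma vanish_le u v m m' : vanish_below u v m -> m' <= m -> vanish_below u v m'.
Proof. by move=> H le d f nf lt; apply: (H d f nf); apply: lt_le_trans le. Qed.

Lemma span_zero (V : zmodType) (P : V -> Prop) f :
  (forall x, P x -> x = 0) -> span P f -> f = 0.
Proof.
by move=> P0; elim=> [|x /P0|x y _ -> _ ->|x _ ->]; rewrite ?addr0 ?oppr0.
Qed.

Lemma vanish_nil : vanish_below [::] [::] 0.
Proof.
move=> d f nf lt; apply: span_zero nf => x nx.
have d0 : d = 0 by case: nx.
by rewrite d0 ltxx in lt.
Qed.

(** The first strand ends at some letter [i] of [v]. Its crossings contribute [pass_deg i v1], its
    dots only raise the degree, and the other strands must make up the rest. *)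
Lemma vanish_cons i u v m :
  (forall v1 v2, v1 ++ i :: v2 = v ->
     vanish_below u (v1 ++ v2) (m - pass_deg i v1)) ->
  vanish_below (i :: u) v m.
Proof.
move=> H d f nf lt; apply: span_zero nf => x nx.
case: nx H lt => {v d f x} v1 v2 k d h D nh -> H lt.
by rewrite (H v1 v2 erefl d h nh) ?lpad0 ?Hcompm0 //; lia.
Qed.

(** Strands keep their labels. *)
Lemma nform_count (P : pred node) u v d (f : Hhom u v) :
  count P u <> count P v -> nform d f -> f = 0.
Proof.
elim: u v d f => [|i u IH] v d f ne nf; apply: span_zero nf => {}f nf.
  have v0 : v = [::] by case: nf.
  by case: ne; rewrite v0.
case: nf ne => {v d f} v1 v2 k d h D nh _ ne.
rewrite (IH _ d h) ?lpad0 ?Hcompm0 // => E; apply: ne.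
by rewrite /= E !count_cat /= addnCA.
Qed.

Lemma span_cyclic (V : zmodType) (P : V -> Prop) (g f : V) :
  (forall x, P x -> exists n : int, x = g *~ n) -> span P f ->
  exists n : int, f = g *~ n.
Proof.
move=> Pg; elim=> [|x /Pg|x y _ [n ->] _ [k ->]|x _ [n ->]] //.
- by exists 0; rewrite mulr0z.
- by exists (n + k); rewrite mulrzDr.
- by exists (- n); rewrite mulrNz.
Qed.

Lemma cyclic_nil : cyclic_at 0 (Hid [::]).
Proof.
move=> f; apply: span_cyclic => x nx; exists 1; rewrite mulr1z.
suff: forall v d (e : v = [::]) (y : Hhom [::] v), nf_nil d y -> Hcast e y = Hid [::].
  by move=> /(_ [::] 0 erefl x nx).
by move=> v d e y ny; case: ny e => e; rewrite Hcast_id.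
Qed.

(** In degree [m] every endpoint of the first strand but one leaves the other strands in a degree
    where all maps vanish; at the remaining endpoint the same happens once there is a dot. *)
Lemma cyclic_cons i u v m v1 v2 (e : v1 ++ i :: v2 = v) (g : Hhom u (v1 ++ v2)) :
  (forall w1 w2, w1 ++ i :: w2 = v -> w1 = v1 /\ w2 = v2 \/
     vanish_below u (w1 ++ w2) (m - pass_deg i w1 + 1)) ->
  vanish_below u (v1 ++ v2) (m - pass_deg i v1) ->
  cyclic_at (m - pass_deg i v1) g ->
  cyclic_at m (Hcast e (pass i v1 v2 ∙ lpad i g)).
Proof.
move=> H V C f; apply: span_cyclic => x nx.
case: nx e H V C => {v f x} w1 w2 k d h D nh -> e H V C.
case: (H w1 w2 erefl) => [[E1 E2]|W]; last first.
  (* The [+ 1] in [H] covers [k = 0], where [h] has degree exactly [m - pass_deg i w1]. *)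
  exists 0; rewrite mulr0z (W d h nh) ?lpad0 ?Hcompm0 //; lia.
subst w1 w2; rewrite Hcast_id.
case: k e H V C => [|k] e H V C; last first.
  exists 0; rewrite mulr0z (V d h nh) ?lpad0 ?Hcompm0 //; lia.
case: (C h); first by rewrite (_ : _ - _ = d) //; lia.
move=> n ->; exists n; rewrite /= Hcomp_1m.
rewrite (additive_mulz (@lpadD i _ _)).
exact: (additive_mulz (@Hcomp_Dr _ _ _ _)).
Qed.

Lemma cons_split_eq (i : node) a (w v1 v2 : word) :
  v1 ++ i :: v2 = nseq a i ++ w ->
  (exists p q, [/\ a = (p + q).+1, v1 = nseq p i & v2 = nseq q i ++ w]) \/
  (exists2 v1', v1 = nseq a i ++ v1' & v1' ++ i :: v2 = w).
Proof.
elim: a v1 => [|a IH] [|x v1] /=; first by right; exists [::].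
- by move=> E; right; exists (x :: v1).
- by case=> ->; left; exists 0%N, a.
case=> -> /IH [[p [q [-> -> ->]]]|[v1' -> E]].
  by left; exists p.+1, q.
by right; exists v1'.
Qed.

Lemma cons_split_neq (i j : node) b (w v1 v2 : word) : i <> j ->
  v1 ++ i :: v2 = nseq b j ++ w ->
  exists2 v1', v1 = nseq b j ++ v1' & v1' ++ i :: v2 = w.
Proof.
move=> ij; elim: b v1 => [|b IH] [|x v1] /=; first by exists [::].
- by move=> E; exists (x :: v1).
- by case=> /ij.
by case=> -> /IH [v1' -> E]; exists v1'.
Qed.

Lemma nseq_cat (i : node) p q (w : word) : nseq p i ++ (nseq q i ++ w) = nseq (p + q) i ++ w.
Proof. by rewrite catA -nseqD. Qed.

Lemma pass_deg_cat i v w : pass_deg i (v ++ w) = pass_deg i v + pass_deg i w.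
Proof. by elim: v => [|j v IH] /=; rewrite ?add0r // IH; ring. Qed.

Lemma pass_deg_eq i a : pass_deg i (nseq a i) = - (a.*2)%:Z.
Proof.
elim: a => [|a IH] //=; rewrite IH (_ : pairing i i = 2); last by case: (i).
lia.
Qed.

Lemma pass_deg_neq i j a : i <> j -> pass_deg i (nseq a j) = a%:Z.
Proof.
move=> ij; elim: a => [|a IH] //=; rewrite IH (_ : pairing i j = -1).
  by lia.
by case: i j ij {IH} => -[].
Qed.

(** The binomial coefficient, in the form of the shift in [Ediv]. *)
Definition tri a : int := ((a * a.-1)./2)%:Z.

Lemma triS a : tri a.+1 = tri a + a%:Z.
Proof.
rewrite /tri /= -PoszD; congr Posz.
have -> : (a.+1 * a = a * a.-1 + a.*2)%N by case: a => //= a; nia.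
by rewrite halfD odd_double andbF doubleK add0n.
Qed.

Lemma tri0 : tri 0 = 0. Proof. by []. Qed.

Lemma triD a b : tri (a + b) = tri a + tri b + a%:Z * b%:Z.
Proof.
elim: a => [|a IH]; first by rewrite !tri0; ring.
by rewrite addSn !triS IH; lia.
Qed.

Lemma tri_double a : (a * a.-1)%:Z = 2 * tri a.
Proof.
elim: a => [|a IH]; first by [].
by rewrite triS mulrDr -IH; case: a {IH} => [|a] /=; nia.
Qed.

Section Bounds.
Variables i j : node.
Hypothesis ij : i <> j.
Let ji : j <> i := nesym ij.

(** The first strand crosses at most all the other strands, with degree -2 each time. *)
Lemma vanish1 c : vanish_below (nseq c i) (nseq c i) (- (2 * tri c)).
Proof.
elim: c => [|c IH]; first by rewrite tri0 mulr0 oppr0; apply: vanish_nil.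
apply: vanish_cons => v1 v2 E.
have := @cons_split_eq i c.+1 [::] v1 v2; rewrite cats0 => /(_ E).
case=> [[p [q [[Ec] -> ->]]]|[[|? ?] _ //]].
rewrite cats0 -nseqD pass_deg_eq -Ec; apply: vanish_le IH _.
rewrite triS; lia.
Qed.

(** Every [j] strand crosses the [a] strands [i] that end on the left, in degree 1 each; equal
    labels give at worst the longest crossings on [b] and on [a + c] strands. *)
Lemma vanish2 a b c :
  vanish_below (nseq b j ++ nseq (a + c) i)
    (nseq a i ++ (nseq b j ++ nseq c i))
    (a%:Z * b%:Z - 2 * tri b - 2 * tri (a + c)).
Proof.
elim: b => [|b IH].
  rewrite /= -nseqD mulr0 tri0 mulr0 subr0 sub0r; exact: vanish1.
apply: vanish_cons => v1 v2 /(cons_split_neq ji)[v1' -> /cons_split_eq].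
case=> [[p [q [[Eb] -> ->]]]|[v ->]]; last first.
  move=> E; have := @cons_split_neq j i c [::] v v2 ji; rewrite cats0 => /(_ E).
  by case=> -[].
rewrite -catA nseq_cat -Eb pass_deg_cat pass_deg_neq // pass_deg_eq.
by apply: vanish_le IH _; rewrite triS; lia.
Qed.

(* If k strands go from the left block to the right block and l in the other
   direction, the least degree exceeds the last line by
   (k + l)(b - a - c) + k^2 + l^2; as k - l = a - a', the minimum has k l = 0. *)
Lemma vanish3 a b c a' c' : (a + c = a' + c')%N -> (a + c <= b)%N ->
  vanish_below (nseq a i ++ (nseq b j ++ nseq c i))
    (nseq a' i ++ (nseq b j ++ nseq c' i))
    (`|a%:Z - a'%:Z| * (b%:Z - a%:Z - c%:Z + `|a%:Z - a'%:Z|)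
      - (tri a + 2 * tri b + tri c + (tri a' + tri c'))).
Proof.
elim: a a' c' => [|a IH] a' c' E le.
  rewrite add0n in E; subst c; rewrite [nseq 0 i ++ _]/=; apply: vanish_le (@vanish2 a' b c') _.
  rewrite triD tri0; lia.
apply: vanish_cons => v1 v2 /cons_split_eq.
case=> [[p [q [Ea -> ->]]]|[v -> /(cons_split_neq ij)[v' ->]]].
  rewrite nseq_cat pass_deg_eq; apply: vanish_le (IH (p + q)%N c' _ _) _; try lia.
  rewrite Ea !triS. 
  have -> : a.+1%:Z - (p + q).+1%:Z = a%:Z - (p + q)%:Z by lia.
  have s1 := ler_norm (a%:Z - (p + q)%:Z).
  have s2 := ler_norm ((p + q)%:Z - a%:Z); rewrite distrC in s2.
  by move: `|_| s1 s2 => s s1 s2; lia.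
move=> F; have := @cons_split_eq i c' [::] v' v2; rewrite cats0 => /(_ F).
case=> [[p [q [Ec -> ->]]]|[[|? ?] _ //]].
rewrite cats0 -!catA -nseqD !pass_deg_cat !pass_deg_eq pass_deg_neq //.
apply: vanish_le (IH a' (p + q)%N _ _) _; try lia.
rewrite Ec !triS.
case: (leqP a' a) => [/subnKC Ek|/subnKC Ek].
  move: (a - a')%N Ek => k Ek.
  have -> : a%:Z - a'%:Z = k%:Z by lia.
  have -> : a.+1%:Z - a'%:Z = k.+1%:Z by lia.
  rewrite !ger0_norm //; lia.
move: (a' - a.+1)%N Ek => k Ek.
have -> : a%:Z - a'%:Z = - k.+1%:Z by lia.
have -> : a.+1%:Z - a'%:Z = - k%:Z by lia.
rewrite !normrN !ger0_norm //; nia.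
Qed.

(** Every [i] strand crosses the [b] strands [j] that end on the right. A [j] strand may end in
    either block, hence the induction on [a + b]. *)
Lemma vanish4 a b n : vanish_below (nseq (a + b) j ++ nseq n i)
    (nseq a j ++ (nseq n i ++ nseq b j))
    (n%:Z * b%:Z - 2 * tri (a + b) - 2 * tri n).
Proof.
move: {2}(a + b)%N (erefl (a + b)%N) => k; elim: k a b => [|k IH] a b E.
  have [-> ->] : a = 0%N /\ b = 0%N by lia.
  rewrite /= cats0 mulr0 !tri0 mulr0 sub0r; apply: vanish_le (@vanish1 n) _; lia.
rewrite E; apply: vanish_cons => v1 v2 /cons_split_eq.
case=> [[p [q [Ea -> ->]]]|[v -> /(cons_split_neq ji)[v' ->]]].
  have Ek : k = (p + q + b)%N by lia.
  rewrite nseq_cat pass_deg_eq Ek; apply: vanish_le (@IH (p + q)%N b _) _; first by [].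
  rewrite triS; lia.
move=> F; have := @cons_split_eq j b [::] v' v2; rewrite cats0 => /(_ F).
case=> [[p [q [Ec -> ->]]]|[[|? ?] _ //]].
have Ek : k = (a + (p + q))%N by lia.
rewrite cats0 -!catA -nseqD !pass_deg_cat !pass_deg_eq pass_deg_neq // Ek.
apply: vanish_le (@IH a (p + q)%N _) _; first by [].
rewrite Ec !triS; lia.
Qed.

(** Strands [i] from the left block cross the [a'] strands [j] that end on the left, those from the
    right block the [c'] strands [j] that end on the right. *)
Lemma vanish5 a c a' c' :
  vanish_below (nseq a i ++ (nseq (a' + c') j ++ nseq c i))
    (nseq a' j ++ (nseq (a + c) i ++ nseq c' j))
    (a%:Z * a'%:Z + c%:Z * c'%:Z - 2 * tri (a' + c') - 2 * tri (a + c)).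
Proof.
elim: a => [|a IH].
  by apply: vanish_le (@vanish4 a' c' c) _; rewrite add0n; lia.
apply: vanish_cons => v1 v2 /(cons_split_neq ij)[v1' -> /cons_split_eq].
case=> [[p [q [[Eb] -> ->]]]|[v _]]; last first.
  move=> E; have := @cons_split_neq i j c' [::] v v2 ij; rewrite cats0 => /(_ E).
  by case=> -[].
rewrite -catA nseq_cat -Eb pass_deg_cat pass_deg_neq // pass_deg_eq.
by apply: vanish_le IH _; rewrite addSn triS; lia.
Qed.

End Bounds.

(** * The lowest degree is spanned by the longest crossing *)

Lemma cyclic_cast u v v' (e : v = v') m (g : Hhom u v) :
  cyclic_at m g -> cyclic_at m (Hcast e g).
Proof. by case: v' / e. Qed.

Lemma Hcast_cast u v v' v'' (e : v = v') (e' : v' = v'') (e'' : v = v'')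
    (f : Hhom u v) :
  Hcast e' (Hcast e f) = Hcast e'' f.
Proof. by case: v'' / e' e'' => e''; case: v' / e e'' => e''; rewrite !Hcast_id. Qed.

(** Dragging a strand through a block of its own label gives the factor [crosses] in the recursion
    for [longest]. *)
Lemma pass_crosses i a w (e : nseq a i ++ i :: w = nseq a.+1 i ++ w) :
  Hcast e (pass i (nseq a i) w) = rpad w (crosses i a).
Proof.
elim: a e => [|a IH] e; first by rewrite Hcast_id rpad_id.
have e' : nseq a i ++ i :: w = nseq a.+1 i ++ w by case: e.
rewrite [pass _ _ _]/= Hcast_comp (Hcast_lpad e') IH.
rewrite [crosses i a.+1]/= rpad_comp -[Htens (Hid [:: i]) _]/(lpad i (crosses i a)).
rewrite rpad_lpad; congr Hcomp.
exact: esym (rpad_crossl w i i (nseq a i)).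
Qed.

Lemma block_cast i a u w (g : Hhom u w) (e : nseq a i ++ i :: w = nseq a.+1 i ++ w) :
  Hcast e (pass i (nseq a i) w ∙ lpad i (Htens (longest i a) g))
  = Htens (longest i a.+1) g.
Proof.
rewrite Hcast_comp pass_crosses [longest i a.+1]/= -[g in RHS]Hcomp_1m Htens_comp.
by congr Hcomp; apply: (tensA_word1 (Hid [:: i]) (longest i a) g).
Qed.

Lemma tm_cast_comp u u1 v v1 w (eu : u1 = u) (ev : v1 = v) (t : tm u1 v1)
    (h : Hhom w u) (e1 : u = u1) (e2 : v1 = v) :
  Hcast e2 (cls t ∙ Hcast e1 h) = cls (tm_cast eu ev t) ∙ h.
Proof.
case: v / ev e2 => e2; case: u / eu e1 h => e1 h.
by rewrite !Hcast_id cast_eq.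
Qed.

Lemma rpad_nil_cast u v w (f : Hhom u v) (h : Hhom w u)
    (e1 : u = u ++ [::]) (e2 : v ++ [::] = v) :
  Hcast e2 (rpad [::] f ∙ Hcast e1 h) = f ∙ h.
Proof.
elim/clsW: f => f; rewrite -[in RHS](cls_unitr f) -(tm_cast_comp _ _ _ _ e1 e2).
by rewrite (cls_tens f (t_id [::])).
Qed.

(** Equality in [vanish1] forces the first strand past all the others at every stage of the
    recursion, which leaves the longest crossing only. *)
Lemma cyclic1 i c : cyclic_at (- (2 * tri c)) (longest i c).
Proof.
elim: c => [|c IH]; first by rewrite tri0 mulr0 oppr0; apply: cyclic_nil.
(* The other strands end at [nseq c i ++ [::]], which is not convertible to [nseq c i]; [e0] casts
   [longest i c] to it. *)
have e0 : nseq c i = nseq c i ++ [::] by rewrite cats0.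
have e : nseq c i ++ [:: i] = nseq c.+1 i by rewrite -[[:: i]]/(nseq 1 i) -nseqD addn1.
have m1 : - (2 * tri c.+1) - pass_deg i (nseq c i) = - (2 * tri c).
  by rewrite pass_deg_eq triS; lia.
have := @cyclic_cons i (nseq c i) _ (- (2 * tri c.+1)) (nseq c i) [::] e (Hcast e0 (longest i c)).
rewrite !m1 Hcast_comp (_ : lpad i _ = Hcast (congr1 (cons i) e0) (lpad i (longest i c))); last first.
  by rewrite (Hcast_lpad e0).
have -> : Hcast e (pass i (nseq c i) [::]) ∙ Hcast (congr1 (cons i) e0) (lpad i (longest i c))
  = longest i c.+1.
  have e2 : nseq c i ++ [:: i] = nseq c.+1 i ++ [::] by rewrite cats0.
  have e3 : nseq c.+1 i ++ [::] = nseq c.+1 i by rewrite cats0.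
  transitivity (crosses i c ∙ lpad i (longest i c)); last by [].
  rewrite -(rpad_nil_cast (crosses i c) _ (congr1 (cons i) e0) e3) -(pass_crosses e2).
  by rewrite Hcast_comp (Hcast_cast _ _ e).
apply.
- move=> v1 v2 E; have := @cons_split_eq i c.+1 [::] v1 v2; rewrite cats0 => /(_ E).
  case=> [[p [q [[Ec] -> ->]]]|[[|? ?] _ //]].
  rewrite cats0 -nseqD pass_deg_eq -Ec.
  case: q Ec => [|q] Ec; [left | right].
    by rewrite Ec addn0.
  apply: vanish_le (@vanish1 i c) _; rewrite triS; lia.
- by rewrite cats0; apply: vanish1.
- exact: cyclic_cast.
Qed.

Lemma cyclic2 i j b c : i <> j ->
  cyclic_at (- (2 * tri b + 2 * tri c)) (Htens (longest j b) (longest i c)).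
Proof.
move=> ij; elim: b => [|b IH].
  by rewrite tri0 mulr0 add0r tens_unitl; apply: cyclic1.
have e : nseq b j ++ j :: nseq c i = nseq b.+1 j ++ nseq c i.
  by rewrite -[j :: _]/(nseq 1 j ++ _) nseq_cat addn1.
rewrite -(block_cast _ e).
have m1 : - (2 * tri b.+1 + 2 * tri c) - pass_deg j (nseq b j) = - (2 * tri b + 2 * tri c).
  by rewrite pass_deg_eq triS; lia.
apply: cyclic_cons; rewrite ?m1 //.
- move=> v1 v2 /cons_split_eq[[p [q [[Eb] -> ->]]]|[v _ E]]; last first.
    have := @cons_split_neq j i c [::] v v2 (nesym ij); rewrite cats0 => /(_ E).
    by case=> -[].
  case: q Eb => [|q] Eb; [left | right]; first by rewrite Eb addn0.
  rewrite nseq_cat pass_deg_eq -Eb.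
  apply: vanish_le (@vanish2 i j ij 0 b c) _; rewrite triS add0n; lia.
- by apply: vanish_le (@vanish2 i j ij 0 b c) _; rewrite add0n; lia.
Qed.

Lemma cyclic3 i j a b c : i <> j -> (a + c <= b)%N ->
  cyclic_at (- (2 * tri a + 2 * tri b + 2 * tri c))
    (Htens (longest i a) (Htens (longest j b) (longest i c))).
Proof.
move=> ij; elim: a => [|a IH] le.
  by rewrite tri0 mulr0 add0r tens_unitl; apply: cyclic2.
have e : nseq a i ++ i :: (nseq b j ++ nseq c i) = nseq a.+1 i ++ (nseq b j ++ nseq c i).
  by rewrite -[i :: _]/(nseq 1 i ++ _) nseq_cat addn1.
rewrite -(block_cast _ e).
have m1 : - (2 * tri a.+1 + 2 * tri b + 2 * tri c) - pass_deg i (nseq a i) =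
    - (2 * tri a + 2 * tri b + 2 * tri c).
  by rewrite pass_deg_eq triS; lia.
have V := @vanish3 i j ij a b c a c erefl (ltnW le).
apply: cyclic_cons; rewrite ?m1 //; last first.
- exact/IH/ltnW.
- by apply: vanish_le V _; lia.
move=> v1 v2 /cons_split_eq[[p [q [[Ea] -> ->]]]|[v -> /(cons_split_neq ij)[v' ->]]].
  case: q Ea => [|q] Ea; [left | right]; first by rewrite Ea addn0.
  rewrite nseq_cat pass_deg_eq -Ea; apply: vanish_le V _; rewrite !triS; lia.
move=> F; have := @cons_split_eq i c [::] v' v2; rewrite cats0 => /(_ F).
case=> [[p [q [Ec -> ->]]]|[[|? ?] _ //]]; right.
rewrite cats0 -!catA -nseqD !pass_deg_cat !pass_deg_eq pass_deg_neq //.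
(* A strand that leaves for the right block forces another one back to the left. By [vanish3] with
   [a' = a + 1] the degree is then above the minimum, because of [le]. *)
apply: vanish_le (@vanish3 i j ij a b c a.+1 (p + q)%N _ _) _; try lia.
rewrite Ec !triS.
have -> : a%:Z - a.+1%:Z = - 1 by lia.
rewrite normrN normr1; lia.
Qed.

(** * The polynomial representation *)

(* Sequences with distinct entries: on them the Demazure operators are defined
   for arbitrary functions, so that no polynomial ring is needed. *)
Record pt := Pt { crd :> nat -> rat; crd_inj : injective crd }.

Lemma ptP (w w' : pt) : (forall k, w k = w' k) -> w = w'.
Proof.
case: w w' => [w hw] [w' hw'] /= e.
have {}e : w = w' by apply: funext.
by case: w' / e hw' => hw'; congr Pt; apply: Prop_irrelevance.
Qed.

Definition trn (n k : nat) := if k == n then n.+1 else if k == n.+1 then n else k.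

Lemma trnK n : involutive (trn n).
Proof. by move=> k; rewrite /trn; do !case: eqP => //; lia. Qed.

Fact sw_subproof n (w : pt) : injective (fun k => w (trn n k)).
Proof. exact: inj_comp (@crd_inj w) (inv_inj (trnK n)). Qed.
Definition sw n (w : pt) : pt := Pt (@sw_subproof n w).

Lemma swE n w k : sw n w k = w (trn n k). Proof. by []. Qed.

Lemma swK n : involutive (sw n).
Proof. by move=> w; apply: ptP => k; rewrite !swE trnK. Qed.

Lemma sw_braid n w : sw n (sw n.+1 (sw n w)) = sw n.+1 (sw n (sw n.+1 w)).
Proof.
apply: ptP => k; rewrite !swE; congr (crd w _).
rewrite /trn.
by do !case: eqP => //; lia.
Qed.

Lemma sw_comm p q w : (p.+1 < q)%N -> sw p (sw q w) = sw q (sw p w).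
Proof.
move=> pq; apply: ptP => k; rewrite !swE; congr (crd w _); rewrite /trn.
by do !case: eqP => //; lia.
Qed.

Lemma sw_left n w : sw n w n = w n.+1.
Proof. by rewrite swE /trn eqxx. Qed.
Lemma sw_right n w : sw n w n.+1 = w n.
Proof. by rewrite swE /trn eqxx; case: eqP => // /eqP; rewrite eqn_leq ltnn. Qed.
Lemma sw_out n w k : k != n -> k != n.+1 -> sw n w k = w k.
Proof. by rewrite swE /trn => /negPf -> /negPf ->. Qed.

Lemma crdB_neq0 (w : pt) m k : m != k -> w m - w k != 0.
Proof. by apply: contraNneq => /eqP; rewrite subr_eq0 => /eqP /(@crd_inj w) ->. Qed.

Definition fn := pt -> rat.

Definition mulx n (F : fn) : fn := fun w => w n * F w.
Definition swap n (F : fn) : fn := fun w => F (sw n w).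
Definition dem n (F : fn) : fn := fun w => (F w - F (sw n w)) / (w n - w n.+1).

(* The factor x + y of the relation (3) is put on the crossing 1 2 -> 2 1. *)
Definition act_cross (i j : node) n (F : fn) : fn :=
  match i, j with
  | n1, n1 | n2, n2 => dem n F
  | n1, n2 => fun w => (w n + w n.+1) * F (sw n w)
  | n2, n1 => swap n F
  end.

(** Here [n] is the coordinate of the first strand. As sequences are infinite, one space of
    functions serves all words and all positions. *)
Fixpoint act u v (t : tm u v) (n : nat) (F : fn) {struct t} : fn :=
  match t with
  | t_id _ => F
  | t_dot _ => mulx n F
  | t_cross i j => act_cross i j n F
  | t_comp _ _ _ g f => act g n (act f n F)
  | t_tens u' _ _ _ f f' => act f n (act f' (n + size u') F)
  | t_zero _ _ => fun _ => 0
  | t_add _ _ f g => fun w => act f n F w + act g n F w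
  | t_opp _ _ f => fun w => - act f n F w
  end.

Definition additive_op (A : fn -> fn) :=
  forall F G, A (fun w => F w + G w) = fun w => A F w + A G w.

Lemma additive_op0 A : additive_op A -> A (fun _ => 0) = fun _ => 0.
Proof.
move=> aA; apply: funext => w.
have := congr1 (fun F => F w) (aA (fun _ => 0) (fun _ => 0)).
have -> : (fun _ : pt => 0 + 0 : rat) = (fun _ => 0) by apply: funext => ?; rewrite addr0.
move: (A _ w) => x /= /eqP; rewrite -{1}[x]addr0 (inj_eq (addrI x)).
by move=> /eqP.
Qed.

Lemma additive_opN A F : additive_op A -> A (fun w => - F w) = fun w => - A F w.
Proof.
move=> aA; apply: funext => w; apply: (@addrI _ (A F w)).
have := congr1 (fun F => F w) (aA F (fun w => - F w)) => /= <-.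
have -> : (fun w => F w - F w) = (fun _ => 0) by apply: funext => ?; rewrite subrr.
by rewrite additive_op0 // subrr.
Qed.

Lemma act_additive u v (t : tm u v) n : additive_op (act t n).
Proof.
elim: t n => {u v} //= [i|i j|u v w g IHg f IHf|u v u' v' f IHf f' IHf'|u v f IHf g IHg|u v f IHf] n F G.
- by apply: funext => w; rewrite /mulx mulrDr.
- by apply: funext => w; case: i j => -[]; rewrite /act_cross /dem /swap /=; ring.
- by rewrite IHf IHg.
- by rewrite IHf' IHf.
- by apply: funext => w; rewrite IHf IHg addrACA.
- by apply: funext => w; rewrite IHf opprD.
Qed.

Lemma act0 u v (t : tm u v) n : act t n (fun _ => 0) = fun _ => 0.
Proof. exact: additive_op0 (act_additive t n). Qed.

(** Needed for the interchange law, where the second factor is shifted by [size u] on one side and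
    by [size v] on the other. *)
Lemma act_size u v (t : tm u v) n F : size u <> size v -> act t n F = fun _ => 0.
Proof.
elim: t n F => {u v} //= [u v w g IHg f IHf|u v u' v' f IHf f' IHf'|u v f IHf g IHg|u v f IHf] n F uv.
- case: (eqVneq (size u) (size v)) => [e|/eqP e]; last by rewrite IHf // act0.
  by rewrite IHg // -e.
- rewrite !size_cat in uv.
  case: (eqVneq (size u) (size v)) => [e|/eqP e]; last by rewrite IHf.
  by rewrite IHf' ?act0 // => e'; apply: uv; rewrite e e'.
- by rewrite IHf // IHg //; apply: funext => w; rewrite addr0.
- by rewrite IHf //; apply: funext => w; rewrite oppr0.
Qed.

Definition commute_op (A B : fn -> fn) := forall F, A (B F) = B (A F).

(** Reduces far commutativity to the elementary operators; [act_act_comm] uses it once for each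
    factor. *)
Lemma act_commute u v (t : tm u v) n B : additive_op B ->
  (forall p, (n <= p < n + size u)%N -> commute_op (mulx p) B) ->
  (forall i j p, (n <= p)%N -> (p.+1 < n + size u)%N ->
     commute_op (act_cross i j p) B) ->
  commute_op (act t n) B.
Proof.
move=> aB; have B0 := additive_op0 aB.
elim: t n => {u v} //= [i|i j|u v w g IHg f IHf|u v u' v' f IHf f' IHf'|u v|u v f IHf g IHg|u v f IHf] n mB cB F.
- by rewrite mB //; lia.
- by rewrite cB //; lia.
- case: (eqVneq (size u) (size v)) => [e|/eqP e].
    by rewrite IHf // IHg // -e.
  by rewrite !(act_size f) // act0 B0.
- rewrite size_cat in mB cB.
  rewrite IHf' ?IHf //.
  + by move=> p h; apply: mB; lia.
  + by move=> i j p h h'; apply: cB; lia.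
  + by move=> p h; apply: mB; lia.
  + by move=> i j p h h'; apply: cB; lia.
- by rewrite B0.
- by rewrite IHf // IHg // aB.
- by rewrite IHf // (additive_opN _ aB).
Qed.

Lemma mulx_comm p q : commute_op (mulx p) (mulx q).
Proof. by move=> F; apply: funext => w; rewrite /mulx mulrCA. Qed.

Lemma cross_mulx_comm i j p q : q != p -> q != p.+1 ->
  commute_op (act_cross i j p) (mulx q).
Proof.
move=> qp qp1 F; apply: funext => w.
case: i j => -[]; rewrite /act_cross /mulx /dem /swap sw_out //; ring.
Qed.

(** A common shape for the four crossings, with coefficients in the two coordinates concerned, so
    that far commutativity needs a single computation. *)
Lemma act_cross_coef i j : exists a b : rat -> rat -> rat, forall p F w,
  act_cross i j p F w = a (w p) (w p.+1) * F w + b (w p) (w p.+1) * F (sw p w).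
Proof.
case: i; case: j.
- exists (fun x y => (x - y)^-1), (fun x y => - (x - y)^-1) => p F w.
  by rewrite /act_cross /dem; ring.
- by exists (fun _ _ => 0), (fun x y => x + y) => p F w; rewrite /act_cross; ring.
- by exists (fun _ _ => 0), (fun _ _ => 1) => p F w; rewrite /act_cross /swap; ring.
- exists (fun x y => (x - y)^-1), (fun x y => - (x - y)^-1) => p F w.
  by rewrite /act_cross /dem; ring.
Qed.

Lemma cross_cross_comm i j k l p q : (p.+1 < q)%N ->
  commute_op (act_cross i j p) (act_cross k l q).
Proof.
move=> pq F; apply: funext => w.
have [a [b E]] := act_cross_coef i j; have [c [d E']] := act_cross_coef k l.
rewrite !(E, E').
have e1 v : sw p v q = v q by rewrite sw_out //; lia.
have e2 v : sw p v q.+1 = v q.+1 by rewrite sw_out //; lia.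
have e3 v : sw q v p = v p by rewrite sw_out //; lia.
have e4 v : sw q v p.+1 = v p.+1 by rewrite sw_out //; lia.
by rewrite !(e1, e2, e3, e4) (sw_comm w pq); ring.
Qed.

Lemma act_act_comm u v u' v' (f : tm u v) (g : tm u' v') n m :
  (n + size u <= m)%N -> commute_op (act f n) (act g m).
Proof.
move=> nm; apply: act_commute; first exact: act_additive.
  move=> p pn F; symmetry; apply: act_commute.
  - by move=> ? ?; apply: funext => w; rewrite /mulx mulrDr.
  - by move=> q qm; apply: mulx_comm.
  - by move=> i j q q1 q2; apply: cross_mulx_comm; lia.
move=> i j p p1 p2 F; symmetry; apply: act_commute.
- exact: (act_additive (t_cross i j) p).
- by move=> q qm F'; rewrite cross_mulx_comm //; lia.
- by move=> k l q q1 q2 F'; symmetry; apply: cross_cross_comm; lia.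
Qed.

Lemma act_cast u u' v v' (eu : u = u') (ev : v = v') (t : tm u v) n :
  act (tm_cast eu ev t) n = act t n.
Proof. by case: u' / eu; case: v' / ev. Qed.

(** The polynomial representation is well defined. The local relations become identities of rational
    expressions, whose denominators are nonzero because points have distinct coordinates. *)
Lemma act_eq u v (s t : tm u v) : tm_eq s t -> forall n, act s n = act t n.
Proof.
have sgn : forall i n F w, act_cross i i n F w = (F w - F (sw n w)) / (w n - w n.+1).
  by case.
have nz (w : pt) n : w n - w n.+1 != 0 by apply: crdB_neq0; rewrite neq_ltn ltnSn.
elim=> {u v s t} [//|u v f g _ IH|u v f g h _ IH1 _ IH2|u v w g g' f f' _ IH1 _ IH2
 |u v u' v' f g f' g' _ IH1 _ IH2|u v f f' g g' _ IH1 _ IH2|u v f f' _ IH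
 |u v f g h|u v f g|u v f|u v f|//|//|//|//|u v w g f f'|//
 |u v w u' v' w' g f g' f'|//|u v u' v' f f' g'|u v u' v' u'' v'' f f' f''|u v f|u v f
 |i|i|i|i j ij|i j ij|i j ij|i j ij|i j k ijk] n; apply: funext => F.
- by rewrite IH.
- by rewrite IH1 IH2.
- by rewrite /= IH1 IH2.
- by rewrite /= IH1 IH2.
- by rewrite /= IH1 IH2.
- by rewrite /= IH.
- by apply: funext => w /=; rewrite addrA.
- by apply: funext => w /=; rewrite addrC.
- by apply: funext => w /=; rewrite add0r.
- by apply: funext => w /=; rewrite addNr.
- by rewrite /= act_additive.
(* Interchange law: for equal sizes [f] and [g'] act on disjoint coordinates, otherwise both sides
   are zero. *)
- rewrite /=; case: (eqVneq (size u) (size v)) => [e|/eqP e].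
    by rewrite -e (act_act_comm f g').
  by rewrite !(act_size f) // !act0.
- by rewrite /= act_additive.
- by rewrite act_cast /= size_cat addnA.
- by rewrite /= addn0.
- by rewrite act_cast.
- apply: funext => w /=; rewrite !sgn /mulx !sgn addn1 sw_left.
  by have h := nz w n; field.
- apply: funext => w /=; rewrite !sgn /mulx !sgn addn1 sw_right.
  by have h := nz w n; field.
- apply: funext => w /=; rewrite !sgn swK sw_left sw_right.
  have := nz w n; have := nz (sw n w) n; rewrite sw_left sw_right => h1 h2.
  by field; rewrite h1 h2.
- apply: funext => w /=.
  by case: i j ij => -[] //= _; rewrite /swap /mulx addn1 ?swK ?sw_left ?sw_right; ring.
- apply: funext => w /=.
  by case: i j ij => -[] //= _; rewrite /swap /mulx addn1 ?swK ?sw_left ?sw_right; ring.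
- apply: funext => w /=.
  by case: i j ij => -[] //= _; rewrite /swap /mulx addn1 ?swK ?sw_left ?sw_right; ring.
- have o1 v : sw n v n.+2 = v n.+2 by rewrite sw_out //; lia.
  have o2 v : sw n.+1 v n = v n by rewrite sw_out //; lia.
  apply: funext => w /=.
  have h : w n - w n.+2 != 0 by apply: crdB_neq0; lia.
  by case: i j ij => -[] //= _; rewrite /swap /dem addn1 !(swK, sw_left, sw_right, o1, o2, sw_braid); field.
- have o1 v : sw n v n.+2 = v n.+2 by rewrite sw_out //; lia.
  have o2 v : sw n.+1 v n = v n by rewrite sw_out //; lia.
  apply: funext => w /=.
  have h1 := nz w n; have h2 := nz w n.+1.
  have h3 : w n - w n.+2 != 0 by apply: crdB_neq0; lia.
  have h4 : w n.+1 - w n != 0 by apply: crdB_neq0; lia.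
  have h5 : w n.+2 - w n.+1 != 0 by apply: crdB_neq0; lia.
  have [t1 t2] : trn n n.+1 = n /\ trn n n.+2 = n.+2.
    by rewrite /trn; do !case: eqP; lia.
  have [t3 t4] : trn n.+1 n = n /\ trn n.+1 n.+1 = n.+2.
    by rewrite /trn; do !case: eqP; lia.
  case: i j k ijk => -[] [] //= ijk; try (by case: ijk).
  all: rewrite /swap /dem addn1 !(swK, sw_left, sw_right, o1, o2, sw_braid, t1, t2, t3, t4).
  all: by field; rewrite ?h1 ?h2 ?h3 ?h4 ?h5.
Qed.

Definition actH u v (f : Hhom u v) (n : nat) : fn -> fn := act (repr f) n.

Lemma actH_cls u v (t : tm u v) n : actH (cls t) n = act t n.
Proof. exact: act_eq (repr_cls t) n. Qed.

Lemma actH_comp u v w (g : Hhom v w) (f : Hhom u v) n F :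
  actH (g ∙ f) n F = actH g n (actH f n F).
Proof. by rewrite [LHS](congr1 (@^~ F) (actH_cls _ n)). Qed.

Lemma actH_tens u v u' v' (f : Hhom u v) (g : Hhom u' v') n F :
  actH (Htens f g) n F = actH f n (actH g (n + size u) F).
Proof. by rewrite [LHS](congr1 (@^~ F) (actH_cls _ n)). Qed.

Lemma actH_id u n F : actH (Hid u) n F = F.
Proof. by rewrite [LHS](congr1 (@^~ F) (actH_cls _ n)). Qed.

Lemma actH_lpad j u v (f : Hhom u v) n F : actH (lpad j f) n F = actH f n.+1 F.
Proof. by rewrite [LHS](actH_tens (Hid [:: j]) f) actH_id addn1. Qed.

Lemma actH_crossl i j w n F : actH (crossl i j w) n F = act_cross i j n F.
Proof.
by rewrite [LHS](actH_tens (cls (t_cross i j)) (Hid w)) actH_id actH_cls.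
Qed.

Lemma actH_dotl i w n F : actH (dotl i w) n F = mulx n F.
Proof. by rewrite [LHS](actH_tens (cls (t_dot i)) (Hid w)) actH_id actH_cls. Qed.

Lemma actH_mulz u v (f : Hhom u v) n F w (k : int) :
  actH (f *~ k) n F w = actH f n F w *~ k.
Proof.
apply: (additive_mulz (f := fun f => actH f n F w)) => {}f g.
by rewrite -(clsK f) -(clsK g) -clsD !actH_cls.
Qed.

(** * Iterated Demazure operators on constants and monic polynomials *)

Definition cst (c : rat) : fn := fun _ => c.

Lemma act_scale u v (t : tm u v) n (c : rat) F :
  act t n (fun w => c * F w) = fun w => c * act t n F w.
Proof.
elim: t n F => {u v} //= [i|i j|u v w g IHg f IHf|u v u' v' f IHf f' IHf'|u v|u v f IHf g IHg|u v f IHf] n F.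
- by apply: funext => w; rewrite /mulx mulrCA.
- by apply: funext => w; case: i j => -[]; rewrite /act_cross /dem /swap /=; ring.
- by rewrite IHf IHg.
- by rewrite IHf' IHf.
- by apply: funext => w; rewrite mulr0.
- by apply: funext => w; rewrite IHf IHg mulrDr.
- by apply: funext => w; rewrite IHf mulrN.
Qed.

(** The action of a strand moving right through [k] strands of its own label; [deml] is the move to
    the left. *)
Fixpoint demr n k (F : fn) : fn :=
  if k is k'.+1 then demr n.+1 k' (dem n F) else F.

Fixpoint deml n k (F : fn) : fn :=
  if k is k'.+1 then dem n (deml n.+1 k' F) else F.

Lemma demlS n k F : deml n k.+1 F = deml n k (dem (n + k) F).
Proof.
elim: k n => [|k IH] n; first by rewrite addn0.
by rewrite [LHS]/= -[dem n.+1 _]/(deml n.+1 k.+1 F) IH addSnnS.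
Qed.

(** The divided difference of [A] with one node at [x], as a polynomial in the other node. *)
Definition diff_quot (A : {poly rat}) (x : rat) := (A - A.[x]%:P) %/ ('X - x%:P).

Lemma diff_quotE A x : diff_quot A x * ('X - x%:P) = A - A.[x]%:P.
Proof.
by rewrite divpK // dvdp_XsubCl /root !hornerE subrr.
Qed.

Lemma diff_quot_horner A x y : x != y -> (A.[x] - A.[y]) / (x - y) = (diff_quot A x).[y].
Proof.
move=> xy; have := congr1 (horner^~ y) (diff_quotE A x).
rewrite !hornerE /= => E; have xy0 : x - y != 0 by rewrite subr_eq0.
by apply: (mulIf xy0); rewrite divfK // -[RHS]opprK -mulrN opprB E opprB.
Qed.

Lemma diff_quot_monic A x k : A \is monic -> size A = k.+2 ->
  diff_quot A x \is monic /\ size (diff_quot A x) = k.+1.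
Proof.
move=> mA sA; have sB : size (A - A.[x]%:P) = k.+2.
  by rewrite size_polyDl ?sA // size_polyN (leq_ltn_trans (size_polyC_leq1 _)).
have mB : A - A.[x]%:P \is monic.
  rewrite monicE lead_coefDl ?(monicP mA) // sA size_polyN.
  by rewrite (leq_ltn_trans (size_polyC_leq1 _)).
have mQ : diff_quot A x \is monic.
  by rewrite -(monicMr _ (monicXsubC x)) diff_quotE.
split=> //; have := congr1 (fun p : {poly rat} => size p) (diff_quotE A x).
rewrite sB size_Mmonic ?monicXsubC ?monic_neq0 // size_XsubC addn2 /=.
by case.
Qed.

(** As [A] is symmetric in the coordinates met, each operator takes a divided difference. This
    lowers the degree by one and keeps the polynomial monic; in degree 0 it is 1. *)
Lemma demr_monic k n (A : pt -> {poly rat}) :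
  (forall w, A w \is monic) -> (forall w, size (A w) = k.+1) ->
  (forall p w, (n <= p < n + k)%N -> A (sw p w) = A w) ->
  demr n k (fun w => (A w).[w n]) = cst 1.
Proof.
elim: k n A => [|k IH] n A mA sA iA.
  apply: funext => w; have /size_poly1P[c c0 E] : size (A w) == 1%N by rewrite sA.
  have := mA w; rewrite /= E monicE lead_coefC => /eqP ->.
  by rewrite hornerC.
rewrite /= -[RHS](IH n.+1 (fun w => diff_quot (A w) (w n))).
- congr demr; apply: funext => w; rewrite /dem sw_left iA; last by lia.
  by rewrite diff_quot_horner // -subr_eq0 crdB_neq0 //; lia.
- by move=> w; case: (diff_quot_monic (w n) (mA w) (sA w)).
- by move=> w; case: (diff_quot_monic (w n) (mA w) (sA w)).
- by move=> p w np; rewrite iA ?sw_out //; lia.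
Qed.

(** As in [demr_monic], but the variable is the right coordinate of each pair, so that every divided
    difference brings a sign. *)
Lemma deml_monic k n (A : pt -> {poly rat}) (c : rat) :
  (forall w, A w \is monic) -> (forall w, size (A w) = k.+1) ->
  (forall p w, (n <= p < n + k)%N -> A (sw p w) = A w) ->
  deml n k (fun w => c * (A w).[w (n + k)%N]) = cst (c * (- 1) ^+ k).
Proof.
elim: k n A c => [|k IH] n A c mA sA iA.
  apply: funext => w; have /size_poly1P[e e0 E] : size (A w) == 1%N by rewrite sA.
  have := mA w; rewrite /= E monicE lead_coefC => /eqP ->.
  by rewrite hornerC.
rewrite demlS exprS mulrA mulrN1 -(IH n (fun w => diff_quot (A w) (w (n + k).+1))).
- congr deml; apply: funext => w; rewrite /dem addnS sw_right iA; last by lia.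
  rewrite -diff_quot_horner; last by rewrite -subr_eq0 crdB_neq0 //; lia.
  have h : w (n + k)%N - w (n + k).+1 != 0 by rewrite crdB_neq0 //; lia.
  have h' : w (n + k).+1 - w (n + k)%N != 0 by rewrite crdB_neq0 //; lia.
  by field; rewrite h h'.
- by move=> w; case: (diff_quot_monic (w (n + k).+1) (mA w) (sA w)).
- by move=> w; case: (diff_quot_monic (w (n + k).+1) (mA w) (sA w)).
- by move=> p w np; rewrite iA ?sw_out //; lia.
Qed.

Lemma actH_crosses i a n F : actH (crosses i a) n F = demr n a F.
Proof.
elim: a n F => [|a IH] n F; first by rewrite [LHS]actH_id.
transitivity (actH (lpad i (crosses i a)) n (actH (crossl i i (nseq a i)) n F)).
  exact: actH_comp.
rewrite actH_lpad IH actH_crossl.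
by case: i {IH}.
Qed.

Lemma actH_dot1X i a k n F : actH (dot1X i a k) n F = fun w => w n ^+ k * F w.
Proof.
elim: k => [|k IH] /=; first by rewrite actH_id; apply: funext => w; rewrite mul1r.
rewrite actH_comp IH actH_dotl /mulx.
by apply: funext => w; rewrite exprS mulrA.
Qed.

(** The first strand contributes [a] divided differences of its power of exponent [a], which give 1;
    the other strands are handled by induction. *)
Lemma actH_longest_delta i a n : actH (longest i a ∙ delta i a) n (cst 1) = cst 1.
Proof.
elim: a n => [|a IH] n; first by rewrite Hcomp_1m actH_id.
have -> : longest i a.+1 ∙ delta i a.+1 =
    (crosses i a ∙ dot1X i a a) ∙ lpad i (longest i a ∙ delta i a).
  rewrite /lpad /= tensl_comp !Hcomp_A; congr Hcomp.
  by rewrite -!Hcomp_A dot1X_comm.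
rewrite 2!actH_comp actH_lpad IH.
rewrite actH_crosses actH_dot1X -[RHS](demr_monic (k := a) (n := n) (A := fun _ => 'X^a)).
- by congr demr; apply: funext => w; rewrite hornerXn mulr1.
- by move=> w; apply: monicXn.
- by move=> w; rewrite size_polyXn.
- by [].
Qed.

(** * The degree zero maps *)

(** The words are parameters of a proposition, so that they can be rewritten by [catA] without casts
    on the expression. *)
Definition reach u v (d : int) (c : rat) :=
  exists2 t : tm u v, tm_deg t d & forall n, act t n (cst 1) = cst c.

Lemma act_cst u v (t : tm u v) n c d :
  act t n (cst 1) = cst c -> act t n (cst d) = cst (d * c).
Proof.
move=> E; have -> : cst d = fun w => d * cst 1 w by apply: funext => w; rewrite mulr1.
by rewrite act_scale E.
Qed.

Lemma reach_id u : reach u u 0 1.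
Proof. by exists (t_id u) => //; apply: deg_id. Qed.

Lemma reach_comp u v w d d' c c' :
  reach u v d c -> reach v w d' c' -> reach u w (d + d') (c * c').
Proof.
case=> [s ds es] [t dt et]; exists (t_comp t s); first by rewrite addrC; apply: deg_comp.
by move=> n /=; rewrite es (act_cst _ (et n)).
Qed.

Lemma reach_tens u v u' v' d d' c c' :
  reach u v d c -> reach u' v' d' c' -> reach (u ++ u') (v ++ v') (d + d') (c * c').
Proof.
case=> [s ds es] [t dt et]; exists (t_tens s t); first exact: deg_tens.
by move=> n /=; rewrite et (act_cst _ (es n)) mulrC.
Qed.

Lemma reach_catl p u v d c : reach u v d c -> reach (p ++ u) (p ++ v) d c.
Proof. by move=> /(reach_tens (reach_id p)); rewrite add0r mul1r. Qed.

Lemma reach_catr p u v d c : reach u v d c -> reach (u ++ p) (v ++ p) d c.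
Proof. by move=> /reach_tens /(_ (reach_id p)); rewrite addr0 mulr1. Qed.

Lemma nseqSr (i : node) a : nseq a.+1 i = nseq a i ++ [:: i].
Proof. by rewrite -[[:: i]]/(nseq 1 i) -nseqD addn1. Qed.

Lemma reach_right_iter i v a d c : reach (i :: v) (v ++ [:: i]) d c ->
  reach (nseq a i ++ v) (v ++ nseq a i) (d *+ a) (c ^+ a).
Proof.
move=> H; elim: a => [|a IH]; first by rewrite cats0; apply: reach_id.
rewrite mulrSr exprSr; apply: reach_comp; first exact: (reach_catl [:: i] IH).
have := reach_catr (nseq a i) H; by rewrite -catA.
Qed.

Lemma reach_left_iter i v a d c : reach (v ++ [:: i]) (i :: v) d c ->
  reach (v ++ nseq a i) (nseq a i ++ v) (d *+ a) (c ^+ a).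
Proof.
move=> H; elim: a => [|a IH]; first by rewrite cats0; apply: reach_id.
rewrite mulrS exprS; apply: (@reach_comp _ (i :: (v ++ nseq a i))).
  have := reach_catr (nseq a i) H; by rewrite -catA.
exact: (reach_catl [:: i] IH).
Qed.

(** * Moving one strand across a word *)

Fixpoint passr i v : tm (i :: v) (v ++ [:: i]) :=
  match v with
  | [::] => t_id [:: i]
  | j :: v' => t_comp (t_tens (t_id [:: j]) (passr i v')) (t_tens (t_cross i j) (t_id v'))
  end.

Fixpoint passl i v : tm (v ++ [:: i]) (i :: v) :=
  match v with
  | [::] => t_id [:: i]
  | j :: v' => t_comp (t_tens (t_cross j i) (t_id v')) (t_tens (t_id [:: j]) (passl i v'))
  end.

Lemma deg_passr i v : tm_deg (passr i v) (pass_deg i v).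
Proof.
elim: v => [|j v IH] /=; first exact: deg_id.
have -> : pass_deg i v - pairing i j = (0 + pass_deg i v) + (- pairing i j + 0).
  by rewrite addr0 add0r.
apply: deg_comp; first exact: (deg_tens (deg_id [:: j]) IH).
exact: (deg_tens (deg_cross i j) (deg_id v)).
Qed.

Lemma deg_passl i v : tm_deg (passl i v) (pass_deg i v).
Proof.
elim: v => [|j v IH] /=; first exact: deg_id.
have -> : pass_deg i v - pairing i j = (- pairing j i + 0) + (0 + pass_deg i v).
  by rewrite addr0 add0r addrC; case: i j {IH} => -[].
apply: deg_comp; first exact: (deg_tens (deg_cross j i) (deg_id v)).
exact: (deg_tens (deg_id [:: j]) IH).
Qed.

Fixpoint act_right i v n F : fn :=
  if v is j :: v' then act_right i v' n.+1 (act_cross i j n F) else F.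
Fixpoint act_left i v n F : fn :=
  if v is j :: v' then act_cross j i n (act_left i v' n.+1 F) else F.

Lemma act_passr i v n F : act (passr i v) n F = act_right i v n F.
Proof. by elim: v n F => //= j v IH n F; rewrite addn1 IH. Qed.

Lemma act_passl i v n F : act (passl i v) n F = act_left i v n F.
Proof. by elim: v n F => //= j v IH n F; rewrite addn1 IH. Qed.

Lemma act_right_cat i v w n F :
  act_right i (v ++ w) n F = act_right i w (n + size v) (act_right i v n F).
Proof. by elim: v n F => [|j v IH] n F /=; rewrite ?addn0 // IH addSnnS. Qed.

Lemma act_left_cat i v w n F :
  act_left i (v ++ w) n F = act_left i v n (act_left i w (n + size v) F).
Proof. by elim: v n => [|j v IH] n /=; rewrite ?addn0 // IH addSnnS. Qed.

Lemma act_right_same i k n F : act_right i (nseq k i) n F = demr n k F.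
Proof. by elim: k n F => //= k IH n F; rewrite IH; case: (i). Qed.

Lemma act_left_same i k n F : act_left i (nseq k i) n F = deml n k F.
Proof. by elim: k n => //= k IH n; rewrite IH; case: (i). Qed.

Lemma reach_swap a : reach (n2 :: nseq a n1) (nseq a n1 ++ [:: n2]) a%:Z 1.
Proof.
exists (passr n2 (nseq a n1)).
  by rewrite -(@pass_deg_neq n2 n1) //; apply: deg_passr.
by move=> n; rewrite act_passr; elim: a n => //= a IH n; apply: IH.
Qed.

(** The factors [x + y] of the crossings of 1 with 2, collected as a monic polynomial in the
    coordinate of the moving strand. *)
Definition shifted_prod c n (w : pt) : {poly rat} :=
  \prod_(k < c) ('X - (- w (n + k)%N)%:P).

Lemma shifted_prod_horner c n w x :
  (shifted_prod c n w).[x] = \prod_(k < c) (x + w (n + k)%N).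
Proof.
by rewrite horner_prod; apply: eq_bigr => k _; rewrite !hornerE /= opprK.
Qed.

Lemma shifted_prod_monic c n w : shifted_prod c n w \is monic.
Proof. exact: monic_prod_XsubC. Qed.

Lemma shifted_prod_size c n w : size (shifted_prod c n w) = c.+1.
Proof. by rewrite size_prod_XsubC [index_enum _]unlock -enumT size_enum_ord. Qed.

Lemma shifted_prod_sw c n w p : (p.+1 < n)%N || (n + c <= p)%N ->
  shifted_prod c n (sw p w) = shifted_prod c n w.
Proof.
move=> h; apply: eq_bigr => k _; rewrite sw_out //; have := ltn_ord k; lia.
Qed.

Lemma act_right_neq c n :
  act_right n1 (nseq c n2) n (cst 1) = fun w => (shifted_prod c n w).[w (n + c)%N].
Proof.
elim: c => [|c IH]; first by apply: funext => w; rewrite shifted_prod_horner big_ord0.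
rewrite nseqSr act_right_cat IH size_nseq; apply: funext => w.
transitivity ((w (n + c)%N + w (n + c).+1) *
  (shifted_prod c n (sw (n + c) w)).[sw (n + c) w (n + c)%N]); first by [].
rewrite sw_left !shifted_prod_horner big_ord_recr mulrC addnS.
rewrite [w _ + w (n + c)%N]addrC; congr (_ * _).
apply: eq_bigr => k _; rewrite sw_out //; have := ltn_ord k; lia.
Qed.

Lemma act_left_neq c n :
  act_left n2 (nseq c n1) n (cst 1) = fun w => (shifted_prod c n.+1 w).[w n].
Proof.
elim: c n => [|c IH] n; first by apply: funext => w; rewrite shifted_prod_horner big_ord0.
apply: funext => w.
transitivity ((w n + w n.+1) * (shifted_prod c n.+2 (sw n w)).[sw n w n.+1]).
  by rewrite /= IH.
rewrite sw_right !shifted_prod_horner big_ord_recl addn0; congr (_ * _).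
apply: eq_bigr => k _; rewrite lift0 addnS -addSn sw_out //; lia.
Qed.

(** The crossings with label 2 turn 1 into a monic polynomial of degree [c], and the [c] crossings
    of equal labels take it back to 1. *)
Lemma reach_passr c :
  reach (n1 :: (nseq c n2 ++ nseq c n1)) ((nseq c n2 ++ nseq c n1) ++ [:: n1])
    (- c%:Z) 1.
Proof.
exists (passr n1 (nseq c n2 ++ nseq c n1)).
  have -> : - c%:Z = pass_deg n1 (nseq c n2 ++ nseq c n1).
    by rewrite pass_deg_cat pass_deg_neq // pass_deg_eq; lia.
  exact: deg_passr.
move=> n; rewrite act_passr act_right_cat act_right_neq act_right_same size_nseq.
apply: demr_monic => [w|w|p w h].
- exact: shifted_prod_monic.
- exact: shifted_prod_size.
- by apply: shifted_prod_sw; lia.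
Qed.

(** Mirror image of [reach_passr]; the sign is that of [deml_monic]. *)
Lemma reach_passl c :
  reach ((nseq c n2 ++ nseq c n1) ++ [:: n2]) (n2 :: (nseq c n2 ++ nseq c n1))
    (- c%:Z) ((- 1) ^+ c).
Proof.
exists (passl n2 (nseq c n2 ++ nseq c n1)).
  have -> : - c%:Z = pass_deg n2 (nseq c n2 ++ nseq c n1).
    by rewrite pass_deg_cat (@pass_deg_neq n2 n1) // pass_deg_eq; lia.
  exact: deg_passl.
move=> n; rewrite act_passl act_left_cat act_left_neq act_left_same size_nseq.
rewrite -[RHS]/(cst _) -[(- 1) ^+ c]mul1r -(@deml_monic c n (shifted_prod c (n + c).+1)).
- by congr deml; apply: funext => w; rewrite mul1r.
- by move=> w; apply: shifted_prod_monic.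
- by move=> w; apply: shifted_prod_size.
- by move=> p w h; apply: shifted_prod_sw; lia.
Qed.

(** With the middle block split as [c + a], its last [a] strands pass the last block, in degree
    [a * c]; then the first block passes the [c] strands 2 and the [c] strands 1, in degree
    [- (a * c)]. *)
Lemma reach_there a c :
  reach (nseq a n1 ++ (nseq (a + c) n2 ++ nseq c n1))
    (nseq c n2 ++ (nseq (a + c) n1 ++ nseq a n2)) 0 1.
Proof.
have S := reach_catl (nseq a n1 ++ nseq c n2) (reach_right_iter a (reach_swap c)).
have P := reach_catr (nseq a n2) (reach_right_iter a (reach_passr c)).
rewrite -!catA in S P.
have := reach_comp S P.
by rewrite !expr1n mulr1 mulNrn subrr addnC !nseqD -!catA.
Qed.

Lemma reach_back a c :
  reach (nseq c n2 ++ (nseq (a + c) n1 ++ nseq a n2))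
    (nseq a n1 ++ (nseq (a + c) n2 ++ nseq c n1)) 0 ((- 1) ^+ (a * c)).
Proof.
have S := reach_catr (nseq c n1 ++ nseq a n2) (reach_right_iter c (reach_swap a)).
have P := reach_catl (nseq a n1) (reach_left_iter a (reach_passl c)).
rewrite -!catA in S P.
have := reach_comp S P.
rewrite !expr1n mul1r -exprM mulnC !nseqD -!catA.
by have -> : a%:Z *+ c + (- c%:Z) *+ a = 0 by rewrite -[_ *+ c]mulr_natr -[_ *+ a]mulr_natr !natz; ring.
Qed.

(** * The objects *)

Lemma longest_idem i a : longest i a ∙ divided_idem i a = longest i a.
Proof. by rewrite /divided_idem Hcomp_A; apply: (longest_delta (killed_longest i a 0)). Qed.

Section Triple.
Variables (i : node) (a b c : nat).

Definition tword : word := nseq a i ++ (nseq b (other i) ++ nseq c i).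

Definition tens3 (f : forall i a, Hhom (nseq a i) (nseq a i)) : Hhom tword tword :=
  Htens (f i a) (Htens (f (other i) b) (f i c)).

Lemma tens3_comp f g : tens3 f ∙ tens3 g = tens3 (fun i a => f i a ∙ g i a).
Proof. by rewrite /tens3 !Htens_comp. Qed.

Definition tidem := tens3 divided_idem.
Definition tlong := tens3 longest.
Definition tdelta := tens3 delta.
Definition ttri : int := tri a + tri b + tri c.

Lemma tidemE : tidem = tdelta ∙ tlong.
Proof. exact: esym (tens3_comp _ _). Qed.

Lemma tlong_idem : tlong ∙ tidem = tlong.
Proof. by rewrite /tlong /tidem tens3_comp /tens3 !longest_idem. Qed.

Lemma tidemP : tidem ∙ tidem = tidem.
Proof. by rewrite {1}tidemE -Hcomp_A tlong_idem -tidemE. Qed.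

Lemma homog_tlong : tlong \in homog (- (2 * ttri)).
Proof.
have H j k : longest j k \in homog (- (2 * tri k)).
  by rewrite -tri_double; apply: homog_longest.
have -> : - (2 * ttri) = - (2 * tri a) + (- (2 * tri b) + - (2 * tri c)).
  by rewrite /ttri; ring.
exact: homog_tens (H _ _) (homog_tens (H _ _) (H _ _)).
Qed.

Lemma homog_tdelta : tdelta \in homog (2 * ttri).
Proof.
have H j k : delta j k \in homog (2 * tri k).
  by rewrite -tri_double; apply: homog_delta.
have -> : 2 * ttri = 2 * tri a + (2 * tri b + 2 * tri c) by rewrite /ttri; ring.
exact: homog_tens (H _ _) (homog_tens (H _ _) (H _ _)).
Qed.

Lemma homog_tidem : tidem \in homog 0.
Proof.
by rewrite tidemE -(subrr (2 * ttri)); apply: homog_comp homog_tdelta homog_tlong.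
Qed.

Lemma actH_tlong_delta n : actH tlong n (actH tdelta n (cst 1)) = cst 1.
Proof.
by rewrite -actH_comp tens3_comp /tens3 !actH_tens !actH_longest_delta.
Qed.

Lemma actH_cst u v (f : Hhom u v) n d e :
  actH f n (cst 1) = cst d -> actH f n (cst e) = cst (e * d).
Proof. exact: act_cst. Qed.

Definition pt0 : pt := @Pt (fun k => k%:R) (fun m k => @mulrIn _ 1 (oner_neq0 _) m k).

(** Applied to the staircase monomial, [n] times D gives the constant [n]. *)
Lemma tlong_mulz (n : int) : tlong *~ n = 0 -> n = 0.
Proof.
move=> E; have := actH_mulz tlong 0 (actH tdelta 0 (cst 1)) pt0 n.
rewrite actH_tlong_delta E actH_cls /= => /esym /eqP.
by rewrite intr_eq0 => /eqP.
Qed.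

Lemma tidem_mulz (n : int) : tidem *~ n = 0 -> n = 0.
Proof.
move=> E; apply: tlong_mulz; rewrite -tlong_idem.
by rewrite -(additive_mulz (@Hcomp_Dr _ _ _ tlong)) E Hcompm0.
Qed.

End Triple.

(** The shift of the word underlying [Etriple], to which each divided power contributes. *)
Definition tdeg a b c (t : int) : int := t - ttri a b c.

Section Raw.
Variables (i : node) (a b c : nat) (t : int).
Variables (i' : node) (a' b' c' : nat) (t' : int).

Local Notation X := (Etriple i a b c t).
Local Notation Y := (Etriple i' a' b' c' t').

(** All index types are products of [unit], so that a morphism is a matrix with one entry. *)
Definition raw (f : hom X Y) : Hhom (tword i a b c) (tword i' a' b' c') :=
  Defs.sval (kval f (tt, (tt, tt)) (tt, (tt, tt))).

Lemma raw_inj : injective raw.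
Proof.
move=> f g e; apply: val_inj; apply: matP => -[[] [[] []]] [[] [[] []]].
exact: val_inj.
Qed.

Lemma raw_homog f : raw f \in homog (tdeg a b c t - tdeg a' b' c' t').
Proof.
have := valP (kval f (tt, (tt, tt)) (tt, (tt, tt))).
congr (is_true (_ \in homog _)).
rewrite /= /tdeg /ttri /tri; ring.
Qed.

Lemma rawD f g : raw (f + g) = raw f + raw g.
Proof. by []. Qed.

End Raw.

Lemma raw_id i a b c t : raw (idm (Etriple i a b c t)) = tidem i a b c.
Proof. by []. Qed.

Lemma raw_comp i a b c t i' a' b' c' t' i'' a'' b'' c'' t''
    (g : hom (Etriple i' a' b' c' t') (Etriple i'' a'' b'' c'' t''))
    (f : hom (Etriple i a b c t) (Etriple i' a' b' c' t')) :
  raw (g ∘ f) = raw g ∙ raw f.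
Proof.
by rewrite {1}/raw /= /matM (bigD1 (tt, (tt, tt))) //= big1 ?addr0.
Qed.

Lemma raw_mulz i a b c t i' a' b' c' t'
    (f : hom (Etriple i a b c t) (Etriple i' a' b' c' t')) (n : int) :
  raw (f *~ n) = raw f *~ n.
Proof. exact: (additive_mulz (@rawD i a b c t i' a' b' c' t')). Qed.

Lemma raw_idem i a b c t i' a' b' c' t'
    (f : hom (Etriple i a b c t) (Etriple i' a' b' c' t')) :
  raw f = tidem i' a' b' c' ∙ raw f.
Proof. by rewrite -(raw_id i' a' b' c' t') -raw_comp comp1m. Qed.

Lemma sval_matM (X Y Z : U) (M : mat Y Z) (N : mat X Y) r p q :
  (forall q', q' = q) ->
  Defs.sval (matM M N r p) = Defs.sval (M r q) ∙ Defs.sval (N q p).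
Proof.
move=> uq; rewrite /matM (bigD1 q) //= big1 ?addr0 // => q' /eqP.
by rewrite (uq q').
Qed.

Lemma raw_surj i a b c t i' a' b' c' t' (h : Hhom (tword i a b c) (tword i' a' b' c')) :
  h \in homog (tdeg a b c t - tdeg a' b' c' t') ->
  exists f : hom (Etriple i a b c t) (Etriple i' a' b' c' t'),
    raw f = tidem i' a' b' c' ∙ h ∙ tidem i a b c.
Proof.
move=> hh.
set h' := tidem i' a' b' c' ∙ h ∙ tidem i a b c.
have hh' : h' \in homog (tdeg a b c t - tdeg a' b' c' t').
  rewrite -[_ - _]addr0; apply: homog_comp (homog_tidem _ _ _ _).
  by rewrite -[_ - _]add0r; apply: homog_comp (homog_tidem _ _ _ _) hh.
pose X := Etriple i a b c t; pose Y := Etriple i' a' b' c' t'.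
pose X0 : U := kcar X; pose Y0 : U := kcar Y.
pose p : fidx (kcar X) := (tt, (tt, tt)); pose q : fidx (kcar Y) := (tt, (tt, tt)).
have hs : (h' : Hhom (kcar X p).1 (kcar Y q).1) \in homog ((kcar X p).2 - (kcar Y q).2).
  move: hh'; congr (is_true (_ \in homog _)).
  by rewrite /= /tdeg /ttri /tri; ring.
pose M : hom (kcar X) (kcar Y) := fun _ _ => SHom hs.
have kM : M \in @kar_pred U X Y.
  apply: kar_predP; apply: matP => -[[] [[] []]] [[] [[] []]]; apply: val_inj.
  have u (x : unit * (unit * unit)) : x = (tt, (tt, tt)) by case: x => [[] [[] []]].
  rewrite [LHS](@sval_matM X0 X0 Y0 _ _ _ _ _ u) (@sval_matM X0 Y0 Y0 _ _ _ _ _ u).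
  rewrite -[LHS]/(tidem i' a' b' c' ∙ h' ∙ tidem i a b c) -[RHS]/h' /h'.
  by rewrite !Hcomp_A tidemP -!Hcomp_A tidemP.
by exists (KHom kM).
Qed.

(* [f] of degree [d] is recovered as [tdelta ∙ (tlong ∙ f)], and [tlong ∙ f] is
   so low in degree that the normal forms leave little room for it. *)
Lemma raw_long i a b c t i' a' b' c' t'
    (f : hom (Etriple i a b c t) (Etriple i' a' b' c' t')) :
  raw f = tdelta i' a' b' c' ∙ (tlong i' a' b' c' ∙ raw f) /\
  nform (t - t' - ttri a b c - ttri a' b' c') (tlong i' a' b' c' ∙ raw f).
Proof.
split; first by rewrite Hcomp_A -tidemE -raw_idem.
apply: homog_nform.
have -> : t - t' - ttri a b c - ttri a' b' c' =
    - (2 * ttri a' b' c') + (tdeg a b c t - tdeg a' b' c' t').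
  by rewrite /tdeg; ring.
exact: homog_comp (homog_tlong _ _ _ _) (raw_homog f).
Qed.

(** * Endomorphisms and indecomposability *)

Lemma other_neq i : i <> other i. Proof. by case: i. Qed.

(** By [cyclic3], D f is a multiple [n] of D, hence f = δ D f is [n] times e = δ D. *)
Lemma raw_end i a b c t (f : hom (Etriple i a b c t) (Etriple i a b c t)) :
  (a + c <= b)%N -> exists n : int, f = idm _ *~ n.
Proof.
move=> le; have [E nf] := raw_long f.
have [|n En] := @cyclic3 i (other i) a b c (@other_neq i) le (tlong i a b c ∙ raw f).
  by move: nf; congr nform; rewrite /ttri; ring.
exists n; apply: raw_inj; rewrite raw_mulz raw_id E En.
by rewrite (additive_mulz (@Hcomp_Dr _ _ _ _)) tidemE.
Qed.

Lemma idm_mulz i a b c t (n : int) : idm (Etriple i a b c t) *~ n = 0 -> n = 0.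
Proof.
by move=> /(congr1 (@raw _ _ _ _ _ _ _ _ _ _)); rewrite raw_mulz raw_id; apply: tidem_mulz.
Qed.

Lemma zero_objectP (C : precat) (X : C) : idm X = 0 -> zero_object X.
Proof.
move=> id0; split=> Y f g.
  by rewrite -(compm1 f) -(compm1 g) id0 !compm0.
by rewrite -(comp1m f) -(comp1m g) id0 !comp0m.
Qed.

Lemma Etriple_indecomposable i a b c t : (a + c <= b)%N ->
  indecomposable (Etriple i a b c t).
Proof.
move=> le; split.
  move=> [_ z]; have := @idm_mulz i a b c t 1.
  by rewrite mulr1z => /(_ (z _ _ _)).
move=> Y Z [i1 [p1 [i2 [p2 [e1 e2 e21 e12 e]]]]].
(* The idempotent of the summand [Y] is an integer [n] with n^2 = n, hence 0 or 1. *)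
have [n En] := raw_end (i1 ∘ p1) le.
have idem : (i1 ∘ p1) ∘ (i1 ∘ p1) = i1 ∘ p1.
  by rewrite compA -(compA i1) e1 compm1.
have : idm (Etriple i a b c t) *~ (n * n - n) = 0.
  move: idem; rewrite En (additive_mulz (fun g g' => compDl g g' (_ *~ n))).
  by rewrite comp1m -mulrzA mulrzBr => ->; rewrite subrr.
move=> /idm_mulz /eqP; rewrite -[X in _ - X]mulr1 -mulrBr mulf_eq0 subr_eq0.
case/orP=> /eqP n01.
  left; apply: zero_objectP.
  have -> : idm Y = p1 ∘ (i1 ∘ p1) ∘ i1 by rewrite compA e1 comp1m e1.
  by rewrite En n01 mulr0z compm0 comp0m.
right; apply: zero_objectP.
have E2 : i2 ∘ p2 = 0.
  by apply: (@addrI _ (i1 ∘ p1)); rewrite e addr0 En n01 mulr1z.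
have -> : idm Z = p2 ∘ (i2 ∘ p2) ∘ i2 by rewrite compA e2 comp1m e2.
by rewrite E2 compm0 comp0m.
Qed.

(** * The exceptional isomorphism *)

Lemma roundtrip i a b c t i' a' b' c' t' k k'
    (p : Hhom (tword i a b c) (tword i' a' b' c'))
    (q : Hhom (tword i' a' b' c') (tword i a b c))
    (f : hom (Etriple i a b c t) (Etriple i' a' b' c' t'))
    (g : hom (Etriple i' a' b' c' t') (Etriple i a b c t)) :
  (a + c <= b)%N ->
  actH p 0 (cst 1) = cst k -> actH q 0 (cst 1) = cst k' ->
  raw f = tidem i' a' b' c' ∙ (tdelta i' a' b' c' ∙ p ∙ tlong i a b c) ∙ tidem i a b c ->
  raw g = tidem i a b c ∙ (tdelta i a b c ∙ q ∙ tlong i' a' b' c') ∙ tidem i' a' b' c' ->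
  exists2 n : int, g ∘ f = idm _ *~ n & n%:~R = k * k'.
Proof.
move=> le Ep Eq Ef Eg; have [n En] := raw_end (g ∘ f) le; exists n => //.
(* After composition with D on the left all idempotents are absorbed by D e = D. *)
have E : tlong i a b c *~ n =
    tlong i a b c ∙ tdelta i a b c ∙ q ∙ tlong i' a' b' c' ∙ tdelta i' a' b' c' ∙ p ∙
    tlong i a b c.
  have := congr1 (@raw _ _ _ _ _ _ _ _ _ _) En; rewrite raw_mulz raw_id raw_comp.
  move=> /(congr1 (Hcomp (tlong i a b c))); rewrite (additive_mulz (@Hcomp_Dr _ _ _ _)).
  rewrite tlong_idem => <-; rewrite Ef Eg !Hcomp_A tlong_idem.
  rewrite -!(Hcomp_A _ (tlong i a b c) (tidem i a b c)) tlong_idem.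
  by do 2!rewrite -(Hcomp_A _ (tlong i' a' b' c') (tidem i' a' b' c')) tlong_idem.
have LD j x y z : actH (tlong j x y z ∙ tdelta j x y z) 0 (cst 1) = cst 1.
  by rewrite actH_comp actH_tlong_delta.
(* Evaluation on the staircase monomial: as every D δ fixes constants, [p] and [q] meet constants
   only and contribute [k] and [k']. *)
have := actH_mulz (tlong i a b c) 0 (actH (tdelta i a b c) 0 (cst 1)) pt0 n.
rewrite E -(Hcomp_A _ (tlong i' a' b' c')).
rewrite [actH (_ ∙ tlong i a b c) _ _]actH_comp actH_tlong_delta.
rewrite [actH (_ ∙ p) _ _]actH_comp Ep.
rewrite [actH (_ ∙ (tlong _ _ _ _ ∙ tdelta _ _ _ _)) _ _]actH_comp (actH_cst _ (LD _ _ _ _)).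
rewrite actH_comp (actH_cst _ Eq) (actH_cst _ (LD _ _ _ _)) /cst !mulr1 => <-.
by [].
Qed.

Lemma Etriple_iso a c t :
  isomorphic (Etriple n1 a (a + c) c t) (Etriple n2 c (a + c) a t).
Proof.
have [s ds es] := reach_there a c; have [r dr er] := reach_back a c.
pose p : Hhom (tword n1 a (a + c) c) (tword n2 c (a + c) a) := cls s.
pose q : Hhom (tword n2 c (a + c) a) (tword n1 a (a + c) c) := cls r.
have sym : ttri c (a + c) a = ttri a (a + c) c by rewrite /ttri; ring.
have Ep : actH p 0 (cst 1) = cst 1 by rewrite actH_cls es.
have Eq : actH q 0 (cst 1) = cst ((- 1) ^+ (a * c)) by rewrite actH_cls er.
have [f Ef] : exists f : hom (Etriple n1 a (a + c) c t) (Etriple n2 c (a + c) a t),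
    raw f = tidem n2 c (a + c) a ∙
      (tdelta n2 c (a + c) a ∙ p ∙ tlong n1 a (a + c) c) ∙ tidem n1 a (a + c) c.
  apply: raw_surj; rewrite /tdeg sym subrr.
  have -> : 0 = (2 * ttri c (a + c) a + 0) + - (2 * ttri a (a + c) c).
    by rewrite sym addr0 subrr.
  apply: homog_comp (homog_tlong _ _ _ _).
  exact: homog_comp (homog_tdelta _ _ _ _) (homog_cls ds).
have [g Eg] : exists g : hom (Etriple n2 c (a + c) a t) (Etriple n1 a (a + c) c t),
    raw g = tidem n1 a (a + c) c ∙
      (tdelta n1 a (a + c) c ∙ q ∙ tlong n2 c (a + c) a) ∙ tidem n2 c (a + c) a.
  apply: raw_surj; rewrite /tdeg sym subrr.
  have -> : 0 = (2 * ttri a (a + c) c + 0) + - (2 * ttri c (a + c) a).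
    by rewrite sym addr0 subrr.
  apply: homog_comp (homog_tlong _ _ _ _).
  exact: homog_comp (homog_tdelta _ _ _ _) (homog_cls dr).
(* Both multipliers are the sign [(- 1) ^+ (a * c)], so that [g *~ n] is inverse to [f]. *)
have [n En n1] := roundtrip (leqnn _) Ep Eq Ef Eg.
have [m Em m1] := roundtrip (eq_leq (addnC c a)) Eq Ep Eg Ef.
have nm : m = n by apply/eqP; rewrite -(eqr_int rat) n1 m1 mulrC.
have nn : n * n = 1.
  by apply/eqP; rewrite -(eqr_int rat) intrM n1 mul1r -exprD addnn -mul2n exprM sqrrN !expr1n.
exists f, (g *~ n); split.
  by rewrite (additive_mulz (fun x y => compDl x y f)) En -mulrzA nn mulr1z.
by rewrite (additive_mulz (compDr f)) Em nm -mulrzA nn mulr1z.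
Qed.

(** * Exclusion of all other isomorphisms *)

Definition is_n1 x := if x is n1 then true else false.

Lemma raw_neq0_count i a b c t i' a' b' c' t'
    (f : hom (Etriple i a b c t) (Etriple i' a' b' c' t')) :
  raw f <> 0 -> forall P : pred node,
  (P i * a + (P (other i) * b + P i * c) = P i' * a' + (P (other i') * b' + P i' * c'))%N.
Proof.
move=> f0 P; have [E nf] := raw_long f.
apply: contrapT => ne; case: f0; rewrite E (nform_count (P := P) _ nf) ?Hcompm0 //.
by rewrite /tword !count_cat !count_nseq.
Qed.

(** The defect in [vanish3] is s (b - a - c) + s^2 with s = |a - a'|, and its first term is
    nonnegative. *)
Lemma raw_neq0_same i a b c t a' c' t'
    (f : hom (Etriple i a b c t) (Etriple i a' b c' t')) :
  (a + c = a' + c')%N -> (a + c <= b)%N -> raw f <> 0 ->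
  (a%:Z - a'%:Z) ^+ 2 <= t - t'.
Proof.
move=> e le f0; have [E nf] := raw_long f; rewrite leNgt; apply/negP => lt.
case: f0; rewrite E (vanish3 (@other_neq i) e le nf) ?Hcompm0 //.
move: lt; rewrite -real_normK ?num_real // /ttri.
move: `|_| (normr_ge0 (a%:Z - a'%:Z)) => s s0 lt.
have : 0 <= s * (b%:Z - a%:Z - c%:Z) by apply: mulr_ge0 => //; lia.
lia.
Qed.

Lemma raw_neq0_cross i a b c t i' a' b' c' t'
    (f : hom (Etriple i a b c t) (Etriple i' a' b' c' t')) :
  i' = other i -> (a + c)%N = b' -> (a' + c')%N = b -> raw f <> 0 ->
  (a%:Z - c'%:Z) * (a'%:Z - c%:Z) <= t - t'.
Proof.
move=> ii eb' eb f0; subst i'; have [E nf] := raw_long f; rewrite leNgt; apply/negP => lt.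
have V : vanish_below (tword i a b c) (tword (other i) a' b' c')
    (a%:Z * a'%:Z + c%:Z * c'%:Z - 2 * tri b - 2 * tri b').
  have := @vanish5 i (other i) (@other_neq i) a c a' c'.
  by rewrite eb' eb; case: (i).
case: f0; rewrite E (V _ _ nf) ?Hcompm0 //.
(* By [triD] the defect is a a' + c c' - a c - a' c', which is the product in the statement. *)
by move: lt; rewrite /ttri -eb -eb' !triD; lia.
Qed.

Lemma iso_neq0 i a b c t i' a' b' c' t' :
  isomorphic (Etriple i a b c t) (Etriple i' a' b' c' t') ->
  exists (f : hom (Etriple i a b c t) (Etriple i' a' b' c' t'))
         (g : hom (Etriple i' a' b' c' t') (Etriple i a b c t)),
    raw f <> 0 /\ raw g <> 0.
Proof.
case=> f [g [gf _]]; exists f, g.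
have e0 : tidem i a b c <> 0.
  by move=> e; have := @tidem_mulz i a b c 1; rewrite mulr1z => /(_ e).
by split=> z; apply: e0; rewrite -(raw_id i a b c t) -gf raw_comp z ?Hcompm0 ?Hcomp0m.
Qed.

Theorem theorem2 :
  (forall (i : node) (a b c : nat) (t : int),
     (a + c <= b)%N -> indecomposable (Etriple i a b c t)) /\
  (forall (a c : nat) (t : int),
     isomorphic (Etriple n1 a (a + c)%N c t) (Etriple n2 c (a + c)%N a t)) /\
  (forall (i : node) (a b c : nat) (t : int)
          (i' : node) (a' b' c' : nat) (t' : int),
     (a + c <= b)%N -> (a' + c' <= b')%N ->
     isomorphic (Etriple i a b c t) (Etriple i' a' b' c' t') ->
     (i, a, b, c, t) = (i', a', b', c', t') \/
     [/\ i' = other i, (b = a + c)%N & (a', b', c', t') = (c, b, a, t)]).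
Proof.
split; first exact: Etriple_indecomposable.
split; first exact: Etriple_iso.
move=> i a b c t i' a' b' c' t' le le' /iso_neq0[f [g [f0 g0]]].
have C := raw_neq0_count f0.
have [C1 C2] := (C is_n1, C (fun x => ~~ is_n1 x)).
case: (pselect (i' = i)) => [ii|ne].
  subst i'; left.
  have [e1 e2] : (a + c = a' + c')%N /\ b = b' by move: C1 C2; case: (i) => /=; lia.
  subst b'.
  (* Maps in both directions bound the square of [a - a'] by [t - t'] and by [t' - t], so it
     vanishes. *)
  have h1 := raw_neq0_same e1 le f0; have h2 := raw_neq0_same (esym e1) le' g0.
  have : a = a' by nia.
  have : t = t' by nia.
  move=> -> ea; subst a'; congr (_, _, _, _, _); lia.
have ii : i' = other i by case: i i' ne {f g f0 g0 C C1 C2} => -[].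
have oi : i = other i' by rewrite ii; case: (i).
right; have [e1 e2] : (a + c)%N = b' /\ (a' + c')%N = b.
  by move: C1 C2; rewrite ii; case: (i) => /=; lia.
(* The hypotheses [le] and [le'] force [a + c = a' + c'], so that both products are the square of
   [a - c']. *)
have h1 := raw_neq0_cross ii e1 e2 f0; have h2 := raw_neq0_cross oi e2 e1 g0.
have ea : a = c' by nia.
have et : t = t' by nia.
split=> //; first by lia.
by congr (_, _, _, _); lia.
Qed.
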